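(* For every $k\in\mathbb Z$ there exists $C_k>0$ such that for all $t\in\mathbb R$, $|\Lambda_k(t)|+|t^3\Lambda_k'(t)|+|t^4\Lambda_k''(t)|+|t^5\Lambda_k'''(t)|\le C_k$.
   Context: Let $M(a,b,\zeta)=\sum_{n\ge0}\frac{(a)_n}{(b)_n}\frac{\zeta^n}{n!}$ be Kummer's function. For $k\in\mathbb Z$ define $$\Lambda_k(t)=9^{\frac16+k}(1+t^2)^{-\frac14-\frac{3k}2}\Big[\tfrac{\Gamma(1/3)}{\Gamma(1/6-k)}M\big(-\tfrac16-k,\tfrac23,-\tfrac{t^3}{9}\big)-\tfrac{t}{9^{1/3}}\tfrac{\Gamma(-1/3)}{\Gamma(-1/6-k)}M\big(\tfrac16-k,\tfrac43,-\tfrac{t^3}{9}\big)\Big].$$ *)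

(* Defs.v *)
From Stdlib Require Import Reals Lra.
From Coquelicot Require Import Coquelicot.
Open Scope R_scope.

Fixpoint poch (a : R) (n : nat) : R :=
  match n with
  | O => 1
  | S m => poch a m * (a + INR m)
  end.

Definition KummerM (a b z : R) : R :=
  Series (fun n => poch a n / poch b n * z ^ n / INR (Factorial.fact n)).

(* Euler's Gamma function, via the Gauss limit formula
   Gamma(x) = lim_{n->oo} n! n^x / (x (x+1) ... (x+n)),
   valid for every real x that is not a nonpositive integer. *)
Definition Gamma (x : R) : R :=
  real (Lim_seq (fun n => INR (Factorial.fact n) * Rpower (INR n) x / poch x (S n))).

Definition Lambda (k : Z) (t : R) : R :=
  Rpower 9 (1/6 + IZR k) * Rpower (1 + t^2) (-1/4 - 3 * IZR k / 2) *
  ( Gamma (1/3) / Gamma (1/6 - IZR k) * KummerM (-1/6 - IZR k) (2/3) (- t^3 / 9)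
    - t / Rpower 9 (1/3) * (Gamma (-1/3) / Gamma (-1/6 - IZR k))
        * KummerM (1/6 - IZR k) (4/3) (- t^3 / 9) ).

(* Main.v *)
Require Import Defs.
From Stdlib Require Import ZArith Reals Lra Lia Psatz.
From Coquelicot Require Import Coquelicot.
Open Scope R_scope.

(* The bracket F in Lambda_k solves F'' + (t^2/3) F' + a t F = 0 with a = -1/6 - k, so
   G = (1 + t^2)^(3a/2) F, which is Lambda_k up to a constant, solves G'' + P G' + Q G = 0
   with P ~ t^2/3 and Q = O(1/t).

   As t -> +oo the equation is dissipative: G^2 + G'^2 stays bounded, and each derivative
   solves y' = - P y + f with f = O(t^-j), hence is O(t^(-j-2)).

   As t -> -oo, put s = -t. The cone |G'| > |G| / s^2 is invariant, outside it G is bounded,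
   and inside it every solution is comparable with the dominant solution
   D = t M(1/6 - k, 4/3, -t^3/9). So G is bounded as soon as F / D -> 0; a bounded G then has
   decaying derivatives because y' = P y + f would otherwise force exponential growth.

   F / D -> 0 amounts to the asymptotic ratio of two Kummer series at x = s^3/9 -> +oo.
   The ratio of their n-th coefficients is equivalent to kappa n^(1/3) by Gauss's product,
   and the weights of the second series concentrate at n ~ x, so the ratio of the series is
   equivalent to kappa x^(1/3). The Gamma factors make this cancel exactly, through
   Gamma(4/3) = Gamma(1/3) / 3 and Gamma(2/3) = - Gamma(-1/3) / 3. *)

(** * Stable and unstable linear equations *)

(** The weight comes from the balance [(t^2/3) F' + a t F = 0], that is [F ~ |t|^(-3a)]: the factor
    [(1 + t^2)^(3a/2)] undoes this power and lowers the coefficient [a t] to [a t / (1 + t^2)], up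
    to terms [O(1/t^2)]. For [a = -1/6 - k] its exponent is [-1/4 - 3k/2]. The obstacle is
    [t -> -oo], where both Kummer functions grow like [exp(s^3/9)] up to powers of [s] and only
    their combination stays of power size. A leading-order comparison of the two series yields no
    more than [F = o(D)], far from boundedness. The cone closes this gap: a solution that is [o(D)]
    along a mere sequence of points can never enter it, hence is bounded. So no asymptotic expansion
    of [M] is needed, only one limit of a ratio of series at positive arguments, where the terms
    eventually keep one sign and cannot cancel. As [t -> +oo] the series eventually alternate, and
    the energy estimate avoids summing them. *)

Lemma growth_lower_bound (h h' Th th : R -> R) (s1 : R) :
  (forall s, s1 <= s -> is_derive h s (h' s)) ->
  (forall s, s1 <= s -> is_derive Th s (th s)) ->
  (forall s, s1 <= s -> th s * h s <= h' s) ->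
  forall s, s1 <= s -> h s1 * exp (Th s - Th s1) <= h s.
Proof.
  intros Hh HT Hle s Hs.
  (* Integrating factor: [h * exp (- Th)] is nondecreasing. No sign of [h] is needed, so upper
     bounds follow by taking [- V], [- g^2] or [M - w^2] for [h]. *)
  set (k := fun x => h x * exp (- Th x)).
  set (k' := fun x => (h' x - th x * h x) * exp (- Th x)).
  assert (Hk : forall x, s1 <= x -> is_derive k x (k' x)).
  { intros x Hx. unfold k, k'.
    evar_last.
    - apply (is_derive_mult h (fun x => exp (- Th x))).
      + apply Hh, Hx.
      + apply (is_derive_comp exp (fun x => - Th x)).
        * apply is_derive_exp.
        * apply (is_derive_opp (V := R_NormedModule)), HT, Hx.
      + intros; apply Rmult_comm.
    - cbv [plus mult scal opp]; simpl; cbv [mult]; simpl. ring. }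
  assert (Hmon : k s1 <= k s).
  { destruct (MVT_gen k s1 s k') as [c [Hc Heq]].
    - intros x Hx. rewrite Rmin_left in Hx by lra. apply Hk. lra.
    - intros x Hx. rewrite Rmin_left in Hx by lra.
      apply continuity_pt_filterlim, (ex_derive_continuous k).
      exists (k' x). apply Hk. lra.
    - rewrite Rmin_left in Hc by lra.
      assert (0 <= k' c).
      { unfold k'. apply Rmult_le_pos; [|left; apply exp_pos].
        specialize (Hle c ltac:(lra)). lra. }
      assert (0 <= k' c * (s - s1)) by (apply Rmult_le_pos; lra). lra. }
  unfold k in Hmon.
  apply Rmult_le_compat_r with (r := exp (Th s)) in Hmon; [|left; apply exp_pos].
  rewrite !Rmult_assoc, <- !exp_plus in Hmon.
  replace (- Th s + Th s) with 0 in Hmon by ring. rewrite exp_0 in Hmon.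
  replace (Th s - Th s1) with (- Th s1 + Th s) by ring. lra.
Qed.

Lemma is_derive_sqr (y : R -> R) (s l : R) :
  is_derive y s l -> is_derive (fun x => (y x)^2) s (2 * y s * l).
Proof.
  intros H. evar_last. apply (is_derive_pow y 2), H. simpl. ring.
Qed.

Lemma is_derive_cube_over (c s : R) : c <> 0 ->
  is_derive (fun x => x^3 / (3 * c)) s (s^2 / c).
Proof.
  intros Hc. auto_derive; [exact I|]. field. exact Hc.
Qed.

Lemma Rabs_le_of_sqr_le (w M : R) : w^2 <= M -> Rabs w <= M + 1.
Proof. intros H. apply Rabs_le. nra. Qed.

Lemma decay_stable (m : nat) (y f P : R -> R) (T C : R) :
  1 <= T -> 12 * INR (S m) <= T -> 0 <= C ->
  (forall s, T <= s -> is_derive y s (- P s * y s + f s)) ->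
  (forall s, T <= s -> s^2 / 6 <= P s) ->
  (forall s, T <= s -> Rabs (f s) * s^(S m) <= C * s^2) ->
  exists K, forall s, T <= s -> Rabs (y s) * s^(S m) <= K.
Proof.
  intros HT Hm HC Hy HP Hf.
  set (w := fun s => y s * s^(S m)).
  set (w' := fun s => (- P s * y s + f s) * s^(S m) + y s * (INR (S m) * s^m)).
  assert (Hw : forall s, T <= s -> is_derive w s (w' s)).
  { intros s Hs. unfold w, w'. evar_last.
    - apply (is_derive_mult y (fun s => s^(S m))).
      + apply Hy, Hs.
      + apply (is_derive_pow (fun s => s) (S m)). apply (@is_derive_id R_AbsRing).
      + intros; apply Rmult_comm.
    - cbv [plus mult one]; simpl. ring. }
  (* Of the damping [s^2/3 * w^2], half absorbs the derivative of [s^(S m)] and a quarter absorbs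
     the forcing, at the cost [12 * C^2 * s^2]. What remains, [s^2/12 * w^2 - 12 * C^2 * s^2],
     equals [- s^2/12 * (M - w^2)] for this [M]. *)
  set (M := 144 * C^2).
  set (h := fun s => M - (w s)^2).
  assert (Hh : forall s, T <= s ->
     h T * exp (- (s^3 / (3*12)) - - (T^3/(3*12))) <= h s).
  { apply (growth_lower_bound h (fun s => - (2 * w s * w' s))
       (fun s => - (s^3/(3*12))) (fun s => - (s^2/12))).
    - intros s Hs. unfold h. evar_last.
      + apply (is_derive_minus (fun _ => M) (fun s => (w s)^2)).
        * apply is_derive_const.
        * apply is_derive_sqr, Hw, Hs.
      + cbv [minus plus opp zero]; simpl. ring.
    - intros s Hs. apply (is_derive_opp (V := R_NormedModule) (fun s => s^3/(3*12))).
      apply is_derive_cube_over. lra.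
    - intros s Hs.
      assert (Hs1 : 1 <= s) by lra.
      assert (E1 : w' s = - P s * w s + f s * s^(S m) + INR (S m) * w s / s).
      { unfold w', w. simpl (s ^ S m). field. lra. }
      rewrite E1. unfold h.
      specialize (HP s Hs). specialize (Hf s Hs).
      set (F := f s * s^(S m)) in *.
      assert (HF : Rabs F <= C * s^2).
      { unfold F. rewrite Rabs_mult, (Rabs_right (s^(S m))); [exact Hf|].
        apply Rle_ge, pow_le. lra. }
      set (W := w s) in *.
      assert (B1 : s^2/6 * W^2 <= P s * W^2) by (apply Rmult_le_compat_r; nra).
      assert (B2 : INR (S m) * W / s * W <= s^2 / 12 * W^2).
      { replace (INR (S m) * W / s * W) with (INR (S m) / s * W^2) by (field; lra).
        apply Rmult_le_compat_r; [nra|].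
        apply Rmult_le_reg_r with s; [lra|]. unfold Rdiv.
        rewrite (Rmult_assoc (INR (S m))), Rinv_l, Rmult_1_r by lra. nra. }
      assert (B3 : 2 * W * F <= s^2 * (W^2 / 12 + 12 * C^2)).
      { assert (W * F <= Rabs W * (C * s^2)).
        { apply Rle_trans with (Rabs (W * F)); [apply Rle_abs|].
          rewrite Rabs_mult. apply Rmult_le_compat_l; [apply Rabs_pos|exact HF]. }
        assert (2 * (Rabs W * C) <= W^2/12 + 12 * C^2).
        { rewrite <- (pow2_abs W). pose proof (pow2_ge_0 (Rabs W - 12 * C)). lra. }
        assert (0 <= s^2) by nra. nra. }
      unfold M. nra. }
  exists (M + Rabs (h T) + 1).
  intros s Hs. specialize (Hh s Hs).
  assert (Hs0 : 0 <= s^(S m)) by (apply pow_le; lra).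
  replace (Rabs (y s) * s^(S m)) with (Rabs (w s)).
  2:{ unfold w. rewrite Rabs_mult, (Rabs_right (s^(S m))); [reflexivity|lra]. }
  apply Rabs_le_of_sqr_le.
  assert (exp (- (s^3 / (3*12)) - - (T^3/(3*12))) <= 1).
  { rewrite <- exp_0. destruct (Req_dec s T) as [->|n].
    - right. f_equal. ring.
    - left. apply exp_increasing. assert (T^3 < s^3); [|lra].
      assert (0 < (s - T) * (s^2 + s*T + T^2)) by (apply Rmult_lt_0_compat; nra).
      lra. }
  assert (- Rabs (h T) <= h s).
  { apply Rle_trans with (2 := Hh).
    pose proof (exp_pos (- (s^3 / (3*12)) - - (T^3/(3*12)))).
    pose proof (Rle_abs (- h T)). rewrite Rabs_Ropp in H1.
    pose proof (Rabs_pos (h T)). nra. }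
  unfold h in H0 at 2. lra.
Qed.

(** If the bound failed at [s1], then [y^2] would grow like [exp (s^3 / 18)] from there on, whereas
    by the mean value theorem the bounded antiderivative [Y] forces [|y| <= 2 B] somewhere in every
    unit interval. *)
Lemma decay_unstable (m : nat) (Y y f P : R -> R) (T B C : R) :
  1 <= T -> 0 <= C ->
  (forall s, T <= s -> is_derive Y s (y s)) ->
  (forall s, T <= s -> Rabs (Y s) <= B) ->
  (forall s, T <= s -> is_derive y s (P s * y s + f s)) ->
  (forall s, T <= s -> s^2 / 6 <= P s) ->
  (forall s, T <= s -> Rabs (f s) * s^m <= C * s^2) ->
  forall s, T <= s -> Rabs (y s) * s^m <= 6 * C.
Proof.
  intros HT HC HY HB Hy HP Hf s1 Hs1.
  apply Rnot_lt_le. intros Hlt.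
  (* The square of [6 q], where [q = C / s1^m] gives [|f s| <= s^2 * q] for all [s >= s1]; then
     [(y^2)' >= s^2/6 * (y^2 - c0)]. *)
  set (c0 := 36 * C^2 / (s1^m)^2).
  assert (Hpow : 0 < s1^m) by (apply pow_lt; lra).
  assert (Hc0 : 0 < (y s1)^2 - c0).
  { unfold c0. rewrite <- (pow2_abs (y s1)).
    apply Rmult_lt_reg_r with ((s1^m)^2); [nra|].
    rewrite Rmult_0_l, Rmult_minus_distr_r. unfold Rdiv.
    rewrite (Rmult_assoc (36 * C^2)), Rinv_l by nra.
    pose proof (Rabs_pos (y s1)).
    assert (0 <= Rabs (y s1) * s1^m) by nra.
    assert ((6*C)^2 < (Rabs (y s1) * s1^m)^2) by nra. nra. }
  set (del := (y s1)^2 - c0) in *.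
  assert (Hh : forall s, s1 <= s ->
     del * exp (s^3 / (3*6) - s1^3/(3*6)) <= (y s)^2 - c0).
  { apply (growth_lower_bound (fun s => (y s)^2 - c0)
       (fun s => 2 * y s * (P s * y s + f s))
       (fun s => s^3/(3*6)) (fun s => s^2/6)).
    - intros s Hs. evar_last.
      + apply (is_derive_minus (fun s => (y s)^2) (fun _ => c0)).
        * apply is_derive_sqr, Hy. lra.
        * apply is_derive_const.
      + cbv [minus plus opp zero]; simpl. ring.
    - intros s Hs. apply is_derive_cube_over. lra.
    - intros s Hs.
      specialize (HP s ltac:(lra)). specialize (Hf s ltac:(lra)).
      assert (Hsm : s1^m <= s^m) by (apply pow_incr; lra).
      assert (HF : Rabs (f s) <= s^2 * (C / s1^m)).
      { apply Rmult_le_reg_r with (s1^m); [lra|].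
        replace (s^2 * (C / s1^m) * s1^m) with (C * s^2) by (field; lra).
        apply Rle_trans with (2 := Hf).
        apply Rmult_le_compat_l; [apply Rabs_pos|exact Hsm]. }
      set (q := C / s1^m) in *.
      replace c0 with (36 * q^2) by (unfold c0, q; field; lra).
      set (W := y s) in *.
      assert (B1 : s^2/6 * W^2 <= P s * W^2) by (apply Rmult_le_compat_r; nra).
      assert (B3 : - (s^2 * (W^2 / 6 + 6 * q^2)) <= 2 * W * f s).
      { assert (- (Rabs W * (s^2 * q)) <= W * f s).
        { apply Rle_trans with (- Rabs (W * f s)).
          - apply Ropp_le_contravar. rewrite Rabs_mult.
            apply Rmult_le_compat_l; [apply Rabs_pos|exact HF].
          - pose proof (Rle_abs (-(W * f s))). rewrite Rabs_Ropp in H. lra. }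
        assert (2 * (Rabs W * q) <= W^2/6 + 6 * q^2).
        { rewrite <- (pow2_abs W). pose proof (pow2_ge_0 (Rabs W - 6 * q)). lra. }
        assert (0 <= s^2) by nra. nra. }
      nra. }
  (* Solves [del * L / 18 = 4 * B^2 + 1]: beyond [s1 + L] the crude bound [exp z >= 1 + z] already
     pushes [y^2] above [(2 B)^2]. *)
  set (L := 18 * (4 * B^2 + 1) / del).
  assert (HL : 0 < L) by (unfold L; apply Rdiv_lt_0_compat; nra).
  destruct (MVT_gen Y (s1 + L) (s1 + L + 1) y) as [c [Hc Heq]].
  - intros x Hx. rewrite Rmin_left in Hx by lra. apply HY. lra.
  - intros x Hx. rewrite Rmin_left in Hx by lra.
    apply continuity_pt_filterlim, (ex_derive_continuous Y).
    exists (y x). apply HY. lra.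
  - rewrite Rmin_left, Rmax_right in Hc by lra.
    replace (s1 + L + 1 - (s1 + L)) with 1 in Heq by ring.
    pose proof (HB (s1 + L) ltac:(lra)) as b1.
    pose proof (HB (s1 + L + 1) ltac:(lra)) as b2.
    apply Rabs_le_between in b1. apply Rabs_le_between in b2.
    assert (Hyc : (y c)^2 <= 4 * B^2) by nra.
    specialize (Hh c ltac:(lra)).
    pose proof (exp_ineq1_le (c^3/(3*6) - s1^3/(3*6))) as He.
    assert (Hcube : c - s1 <= c^3 - s1^3).
    { replace (c^3 - s1^3) with ((c - s1) * (c^2 + c*s1 + s1^2)) by ring.
      assert (1 <= c^2 + c*s1 + s1^2) by nra.
      rewrite <- (Rmult_1_r (c - s1)) at 1. apply Rmult_le_compat_l; lra. }
    assert (0 <= c0).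
    { unfold c0. apply Rdiv_le_0_compat; nra. }
    assert (HLd : del * (L / 18) = 4 * B^2 + 1) by (unfold L; field; lra).
    assert (del * (L/18) <= del * exp (c^3/(3*6) - s1^3/(3*6))).
    { apply Rmult_le_compat_l; lra. }
    lra.
Qed.

(** [V = g^2 + g1^2] satisfies [V' <= c / s^2 * V], an integrable rate. Completing the square, the
    damping [s^2/3 * g1^2] absorbs the cross term [2 (1 - Q) g g1] at the cost
    [3 (1 - Q)^2 / s^2 * g^2], which dictates [c]. *)
Lemma bounded_stable (g g1 P Q : R -> R) (T C : R) :
  1 <= T -> 0 <= C ->
  (forall s, T <= s -> is_derive g s (g1 s)) ->
  (forall s, T <= s -> is_derive g1 s (- P s * g1 s - Q s * g s)) ->
  (forall s, T <= s -> s^2 / 6 <= P s) ->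
  (forall s, T <= s -> Rabs (Q s) * s <= C) ->
  exists B, forall s, T <= s -> Rabs (g s) <= B.
Proof.
  intros HT HC Hg Hg1 HP HR.
  set (c := 3 * (1 + C)^2).
  set (V := fun s => (g s)^2 + (g1 s)^2).
  assert (Hc : 0 <= c) by (unfold c; nra).
  assert (HV : forall s, T <= s -> - V T * exp (- c / s - - c / T) <= - V s).
  { apply (growth_lower_bound (fun s => - V s)
      (fun s => - (2 * g s * g1 s + 2 * g1 s * (- P s * g1 s - Q s * g s)))
      (fun s => - c / s) (fun s => c / s^2)).
    - intros s Hs. apply (is_derive_opp (V := R_NormedModule) V).
      unfold V. apply (is_derive_plus (V := R_NormedModule)
        (fun s => (g s)^2) (fun s => (g1 s)^2)); apply is_derive_sqr; auto.
    - intros s Hs. auto_derive; [lra|field; lra].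
    - intros s Hs. specialize (HP s Hs). specialize (HR s Hs).
      assert (Hs1 : 1 <= s) by lra.
      assert (HRC : Rabs (1 - Q s) <= 1 + C).
      { apply Rle_trans with (1 := Rabs_triang _ _).
        rewrite Rabs_R1, Rabs_Ropp. pose proof (Rabs_pos (Q s)). nra. }
      unfold V.
      set (x := g s) in *. set (z := g1 s) in *. set (r := 1 - Q s) in *.
      replace (Q s) with (1 - r) by (unfold r; ring).
      assert (Hr2 : r^2 <= (1 + C)^2).
      { rewrite <- (pow2_abs r). apply pow_incr. split; [apply Rabs_pos|exact HRC]. }
      assert (B1 : s^2/6 * z^2 <= P s * z^2) by (apply Rmult_le_compat_r; nra).
      assert (B2 : 2 * r * (x * z) <= s^2/3 * z^2 + c / s^2 * x^2).
      { assert (E : 0 <= s^2/3 * (z - 3 * r * x / s^2)^2)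
          by (apply Rmult_le_pos; [nra|apply pow2_ge_0]).
        replace (s^2/3 * (z - 3 * r * x / s^2)^2)
          with (s^2/3 * z^2 - 2 * r * (x * z) + 3 * r^2 / s^2 * x^2) in E
          by (field; lra).
        assert (3 * r^2 / s^2 * x^2 <= c / s^2 * x^2).
        { apply Rmult_le_compat_r; [nra|]. unfold Rdiv.
          apply Rmult_le_compat_r; [left; apply Rinv_0_lt_compat; nra|].
          unfold c. lra. }
        lra. }
      assert (B3 : 0 <= c / s^2 * z^2).
      { apply Rmult_le_pos; [apply Rdiv_le_0_compat; nra|nra]. }
      lra. }
  exists (V T * exp (c / T) + 1).
  intros s Hs. apply Rabs_le_of_sqr_le.
  specialize (HV s Hs).
  assert (exp (- c / s - - c / T) <= exp (c / T)).
  { assert (0 <= c / s) by (apply Rdiv_le_0_compat; lra).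
    destruct (Req_dec (- c / s - - c / T) (c / T)) as [->|n]; [lra|].
    left. apply exp_increasing. unfold Rdiv in *. lra. }
  assert (0 <= V T) by (unfold V; nra).
  assert (V T * exp (- c / s - - c / T) <= V T * exp (c / T))
    by (apply Rmult_le_compat_l; assumption).
  unfold V in HV at 2. nra.
Qed.

(** The slope [1 / s^2] of the cone is a compromise: an exponent above 1 makes it integrable, so
    that solutions outside stay bounded, and an exponent below 3 lets [P], of order [s^2], beat
    [Q = O(1/s)] on the boundary. *)
Definition cone (g g1 : R -> R) (s : R) : R := (g1 s)^2 - (g s)^2 / s^4.

(** The point is [cone' >= s * cone]. The cross term has coefficient [r = Q + 1/s^4], of order
    [1/s], and is split into [s^2/6 * g1^2], half of what [P] supplies, and [g^2/s^3], which is [s]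
    times the negative part of [cone]. The split needs [6 * (C + 1)^2 <= s]. *)
Lemma cone_invariant (g g1 P Q : R -> R) (T C : R) :
  6 <= T -> 0 <= C -> 6 * (C + 1)^2 <= T ->
  (forall s, T <= s -> is_derive g s (g1 s)) ->
  (forall s, T <= s -> is_derive g1 s (P s * g1 s - Q s * g s)) ->
  (forall s, T <= s -> s^2 / 6 <= P s) ->
  (forall s, T <= s -> Rabs (Q s) * s <= C) ->
  forall s1 s, T <= s1 -> s1 <= s -> 0 < cone g g1 s1 -> 0 < cone g g1 s.
Proof.
  intros HT HC HTC Hg Hg1 HP HR s1 s Hs1 Hs Hpos.
  assert (H : cone g g1 s1 * exp (s^2/2 - s1^2/2) <= cone g g1 s).
  { apply (growth_lower_bound (cone g g1)
     (fun s => 2 * g1 s * (P s * g1 s - Q s * g s)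
               - (2 * g s * g1 s / s^4 - 4 * (g s)^2 / s^5))
     (fun s => s^2/2) (fun s => s)); [| | |exact Hs].
    - intros u Hu. unfold cone. evar_last.
      + apply (is_derive_minus (fun s => (g1 s)^2) (fun s => (g s)^2 / s^4)).
        * apply is_derive_sqr, Hg1. lra.
        * apply (is_derive_div (fun s => (g s)^2) (fun s => s^4)).
          -- apply is_derive_sqr, Hg. lra.
          -- apply (is_derive_pow (fun s => s) 4). apply (@is_derive_id R_AbsRing).
          -- apply pow_nonzero. lra.
      + cbv [minus plus opp one]; simpl. field. lra.
    - intros u Hu. auto_derive; [exact I|field].
    - intros u Hu. specialize (HP u ltac:(lra)). specialize (HR u ltac:(lra)).
      assert (Hu6 : 6 <= u) by lra.
      unfold cone.
      set (x := g u) in *. set (z := g1 u) in *.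
      assert (B1 : u^2/6 * z^2 <= P u * z^2) by (apply Rmult_le_compat_r; nra).
      assert (B0 : 0 <= 4 * x^2 / u^5).
      { apply Rdiv_le_0_compat; [nra|apply pow_lt; lra]. }
      set (r := Q u + / u^4).
      assert (Hr : Rabs r * u <= C + 1).
      { apply Rle_trans with (Rabs (Q u) * u + / u^4 * u).
        - rewrite <- Rmult_plus_distr_r. apply Rmult_le_compat_r; [lra|].
          unfold r. apply Rle_trans with (1 := Rabs_triang _ _).
          rewrite (Rabs_right (/ u^4)); [lra|].
          apply Rle_ge. left. apply Rinv_0_lt_compat, pow_lt. lra.
        - assert (/ u^4 * u <= 1); [|lra].
          replace (/ u^4 * u) with (/ u^3) by (field; lra).
          rewrite <- Rinv_1. apply Rinv_le_contravar; [lra|].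
          apply pow_R1_Rle. lra. }
      assert (Hr2 : r^2 * u^3 <= u^2 / 6).
      { assert ((Rabs r * u)^2 <= (C + 1)^2).
        { apply pow_incr. split; [|exact Hr].
          apply Rmult_le_pos; [apply Rabs_pos|lra]. }
        rewrite <- (pow2_abs r).
        replace (Rabs r ^2 * u^3) with ((Rabs r * u)^2 * u) by ring.
        assert ((Rabs r * u)^2 * u <= (C+1)^2 * u) by (apply Rmult_le_compat_r; lra).
        nra. }
      assert (B2 : 2 * r * (x * z) <= u^2/6 * z^2 + x^2 / u^3).
      { assert (E : 0 <= / u^3 * (x - r * u^3 * z)^2).
        { apply Rmult_le_pos; [|apply pow2_ge_0].
          left. apply Rinv_0_lt_compat, pow_lt. lra. }
        replace (/ u^3 * (x - r * u^3 * z)^2)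
          with (x^2 / u^3 - 2 * r * (x * z) + r^2 * u^3 * z^2) in E by (field; lra).
        assert (r^2 * u^3 * z^2 <= u^2/6 * z^2) by (apply Rmult_le_compat_r; nra).
        lra. }
      assert (B4 : u * z^2 <= u^2 / 6 * z^2) by (apply Rmult_le_compat_r; nra).
      replace (u * (z^2 - x^2 / u^4)) with (u * z^2 - x^2 / u^3) by (field; lra).
      replace (2 * x * z / u^4) with (2 * (/ u^4) * (x * z)) by (field; lra).
      replace (Q u) with (r - / u^4) by (unfold r; ring).
      lra. }
  apply Rlt_le_trans with (2 := H).
  apply Rmult_lt_0_compat; [exact Hpos|apply exp_pos].
Qed.

(** Outside the cone [(g^2)' <= 2 / s^2 * g^2], and the rate has the bounded antiderivative
    [- 2 / s]. *)
Lemma bounded_outside_cone (g g1 : R -> R) (T : R) :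
  1 <= T ->
  (forall s, T <= s -> is_derive g s (g1 s)) ->
  (forall s, T <= s -> cone g g1 s <= 0) ->
  exists B, forall s, T <= s -> Rabs (g s) <= B.
Proof.
  intros HT Hg Hq.
  assert (H : forall s, T <= s -> - (g T)^2 * exp (- 2 / s - - 2 / T) <= - (g s)^2).
  { apply (growth_lower_bound (fun s => - (g s)^2) (fun s => - (2 * g s * g1 s))
      (fun s => - 2 / s) (fun s => 2 / s^2)).
    - intros s Hs. apply (is_derive_opp (V := R_NormedModule) (fun s => (g s)^2)).
      apply is_derive_sqr; auto.
    - intros s Hs. auto_derive; [lra|field; lra].
    - intros s Hs. specialize (Hq s Hs). unfold cone in Hq.
      assert (E : 0 <= s^2 * (g1 s - g s / s^2)^2)
        by (apply Rmult_le_pos; apply pow2_ge_0).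
      replace (s^2 * (g1 s - g s / s^2)^2)
        with (s^2 * ((g1 s)^2 - (g s)^2 / s^4) - 2 * g s * g1 s + 2 / s^2 * (g s)^2) in E
        by (field; lra).
      assert (0 <= s^2) by nra. nra. }
  exists ((g T)^2 * exp (2 / T) + 1).
  intros s Hs. apply Rabs_le_of_sqr_le.
  specialize (H s Hs).
  assert (exp (- 2 / s - - 2 / T) <= exp (2 / T)).
  { left. apply exp_increasing.
    assert (0 < 2 / s) by (apply Rdiv_lt_0_compat; lra). unfold Rdiv in *. lra. }
  assert ((g T)^2 * exp (- 2 / s - - 2 / T) <= (g T)^2 * exp (2 / T))
    by (apply Rmult_le_compat_l; [apply pow2_ge_0|assumption]).
  lra.
Qed.

(* If [g] entered the cone at [s1], so would [g - nu d] for all small [nu]; hence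
   [g' <> nu d'] from there on, and Rolle keeps [g / d] away from [0]. *)
Lemma bounded_unstable (g g1 d d1 P Q : R -> R) (T C : R) :
  6 <= T -> 0 <= C -> 6 * (C + 1)^2 <= T ->
  (forall s, T <= s -> is_derive g s (g1 s)) ->
  (forall s, T <= s -> is_derive g1 s (P s * g1 s - Q s * g s)) ->
  (forall s, T <= s -> is_derive d s (d1 s)) ->
  (forall s, T <= s -> is_derive d1 s (P s * d1 s - Q s * d s)) ->
  (forall s, T <= s -> s^2 / 6 <= P s) ->
  (forall s, T <= s -> Rabs (Q s) * s <= C) ->
  (forall eps M, 0 < eps -> exists s, M <= s /\ M <= Rabs (d s) /\
     Rabs (g s) <= eps * Rabs (d s)) ->
  exists B, forall s, T <= s -> Rabs (g s) <= B.
Proof.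
  intros HT HC HTC Hg Hg1 Hd Hd1 HP HR Hsmall.
  apply (bounded_outside_cone g g1 T); [lra|exact Hg|].
  intros s1 Hs1. apply Rnot_lt_le. intros Hpos.
  assert (Hcont : exists nu0, 0 < nu0 /\ forall nu, Rabs nu <= nu0 ->
     0 < cone (fun s => g s - nu * d s) (fun s => g1 s - nu * d1 s) s1).
  { set (q := fun nu => cone (fun s => g s - nu * d s) (fun s => g1 s - nu * d1 s) s1).
    assert (Hq : continuous q 0).
    { apply (ex_derive_continuous q). unfold q, cone. auto_derive. exact I. }
    assert (Hq0 : q 0 = cone g g1 s1).
    { unfold q, cone. rewrite !Rmult_0_l, !Rminus_0_r. reflexivity. }
    destruct (Hq (fun y => 0 < y)) as [e He].
    { apply (open_gt 0). rewrite Hq0. exact Hpos. }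
    exists (e / 2). pose proof (cond_pos e). split; [lra|].
    intros nu Hnu. apply He. change (Rabs (nu - 0) < e).
    rewrite Rminus_0_r. lra. }
  destruct Hcont as [nu0 [Hnu0 Hcone]].
  (* With this [eps] and the next [M], [|d s - d s1| >= 3/4 |d s|] and
     [|g s - g s1| <= nu0/2 |d s|]. Hence the slope [nu] that gives [g - nu d] equal values at [s1]
     and [s] satisfies [|nu| <= nu0]. The [+ 1] in [M] keeps [d s] away from [d s1]. *)
  set (eps := nu0 / 4).
  set (M := Rmax (s1 + 1) (4 * Rabs (d s1) + 4 / nu0 * Rabs (g s1) + 1)).
  destruct (Hsmall eps M ltac:(unfold eps; lra)) as [s [HMs [HMd Hgd]]].
  assert (Hs : s1 + 1 <= s) by (apply Rle_trans with (2 := HMs); apply Rmax_l).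
  assert (Hds : 4 * Rabs (d s1) + 4 / nu0 * Rabs (g s1) + 1 <= Rabs (d s))
    by (apply Rle_trans with (2 := HMd); apply Rmax_r).
  assert (Hpg : 0 <= 4 / nu0 * Rabs (g s1)).
  { apply Rmult_le_pos; [left; apply Rdiv_lt_0_compat; lra|apply Rabs_pos]. }
  assert (Hdd : 3/4 * Rabs (d s) <= Rabs (d s - d s1)).
  { pose proof (Rabs_triang_inv (d s) (d s1)). pose proof (Rabs_pos (g s1)). lra. }
  assert (Hdne : d s - d s1 <> 0).
  { intros E. rewrite E, Rabs_R0 in Hdd. pose proof (Rabs_pos (d s1)). lra. }
  set (nu := (g s - g s1) / (d s - d s1)).
  assert (Hnu : Rabs nu <= nu0).
  { unfold nu, Rdiv. rewrite Rabs_mult, Rabs_inv.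
    apply Rmult_le_reg_r with (Rabs (d s - d s1)); [apply Rabs_pos_lt; exact Hdne|].
    rewrite Rmult_assoc, Rinv_l, Rmult_1_r by (apply Rabs_no_R0; exact Hdne).
    apply Rle_trans with (Rabs (g s) + Rabs (g s1)).
    { unfold Rminus. rewrite <- (Rabs_Ropp (g s1)). apply Rabs_triang. }
    assert (Rabs (g s1) = nu0 / 4 * (4 / nu0 * Rabs (g s1))) by (field; lra).
    assert (nu0 * (3/4 * Rabs (d s)) <= nu0 * Rabs (d s - d s1))
      by (apply Rmult_le_compat_l; lra).
    assert (nu0 / 4 * (4 / nu0 * Rabs (g s1)) <= nu0/4 * Rabs (d s)).
    { apply Rmult_le_compat_l; [lra|]. pose proof (Rabs_pos (d s1)). lra. }
    unfold eps in Hgd. pose proof (Rabs_pos (d s)).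
    assert (0 <= nu0 * Rabs (d s)) by (apply Rmult_le_pos; lra).
    lra. }
  set (h := fun s => g s - nu * d s). set (h1 := fun s => g1 s - nu * d1 s).
  assert (Hh : forall u, T <= u -> is_derive h u (h1 u)).
  { intros u Hu. unfold h, h1. apply (is_derive_minus (V := R_NormedModule)).
    - apply Hg, Hu.
    - apply is_derive_scal, Hd, Hu. }
  assert (Hcs : forall u, s1 <= u -> 0 < cone h h1 u).
  { intros u Hu.
    apply (cone_invariant h h1 P Q T C HT HC HTC Hh) with s1; auto.
    - intros v Hv. unfold h, h1. evar_last.
      + apply (is_derive_minus (V := R_NormedModule)).
        * apply Hg1, Hv.
        * apply is_derive_scal, Hd1, Hv.
      + cbv [minus plus opp]; simpl. ring.
    - apply Hcone, Hnu. }
  destruct (MVT_gen h s1 s h1) as [c [Hc Heq]].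
  - intros x Hx. rewrite Rmin_left in Hx by lra. apply Hh. lra.
  - intros x Hx. rewrite Rmin_left in Hx by lra.
    apply continuity_pt_filterlim, (ex_derive_continuous h).
    exists (h1 x). apply Hh. lra.
  - rewrite Rmin_left in Hc by lra.
    assert (Hz : h s - h s1 = 0) by (unfold h, nu; field; exact Hdne).
    rewrite Hz in Heq.
    assert (Hc0 : h1 c = 0).
    { symmetry in Heq. apply Rmult_integral in Heq. destruct Heq; lra. }
    specialize (Hcs c ltac:(lra)). unfold cone in Hcs. rewrite Hc0 in Hcs.
    assert (0 <= (h c)^2 / c^4).
    { apply Rdiv_le_0_compat; [apply pow2_ge_0|apply pow_lt; lra]. }
    lra.
Qed.

(** * Orders of magnitude on a half-line *)

Definition bigO (T : R) (n : Z) (f : R -> R) : Prop :=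
  exists C, 0 <= C /\ forall s, T <= s -> Rabs (f s) <= C * powerRZ s n.

Lemma bigO_ext (T : R) (n : Z) (f g : R -> R) :
  (forall s, T <= s -> f s = g s) -> bigO T n f -> bigO T n g.
Proof.
  intros H [C [HC HB]]. exists C. split; [exact HC|].
  intros s Hs. rewrite <- H by exact Hs. auto.
Qed.

Lemma powerRZ_ge0 (s : R) (n : Z) : 1 <= s -> 0 <= powerRZ s n.
Proof. intros. left. apply powerRZ_lt. lra. Qed.

Lemma bigO_weaken (T : R) (m n : Z) (f : R -> R) :
  1 <= T -> bigO T m f -> (m <= n)%Z -> bigO T n f.
Proof.
  intros HT [C [HC HB]] Hmn. exists C. split; [exact HC|].
  intros s Hs. apply Rle_trans with (1 := HB s Hs).
  apply Rmult_le_compat_l; [exact HC|].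
  replace n with (m + Z.of_nat (Z.to_nat (n - m)))%Z by lia.
  rewrite powerRZ_add by lra. rewrite <- pow_powerRZ.
  rewrite <- (Rmult_1_r (powerRZ s m)) at 1.
  apply Rmult_le_compat_l; [apply powerRZ_ge0; lra|apply pow_R1_Rle; lra].
Qed.

Lemma bigO_plus (T : R) (n : Z) (f g : R -> R) :
  bigO T n f -> bigO T n g -> bigO T n (fun s => f s + g s).
Proof.
  intros [C [HC HB]] [D [HD HE]]. exists (C + D). split; [lra|].
  intros s Hs. apply Rle_trans with (1 := Rabs_triang _ _).
  rewrite Rmult_plus_distr_r. apply Rplus_le_compat; auto.
Qed.

Lemma bigO_opp (T : R) (n : Z) (f : R -> R) :
  bigO T n f -> bigO T n (fun s => - f s).
Proof.
  intros [C [HC HB]]. exists C. split; [exact HC|].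
  intros s Hs. rewrite Rabs_Ropp. auto.
Qed.

Lemma bigO_minus (T : R) (n : Z) (f g : R -> R) :
  bigO T n f -> bigO T n g -> bigO T n (fun s => f s - g s).
Proof. intros. apply bigO_plus; [|apply bigO_opp]; assumption. Qed.

Lemma bigO_mult (T : R) (m n : Z) (f g : R -> R) :
  1 <= T -> bigO T m f -> bigO T n g -> bigO T (m + n) (fun s => f s * g s).
Proof.
  intros HT [C [HC HB]] [D [HD HE]]. exists (C * D). split; [nra|].
  intros s Hs. rewrite Rabs_mult, powerRZ_add by lra.
  replace (C * D * (powerRZ s m * powerRZ s n))
    with ((C * powerRZ s m) * (D * powerRZ s n)) by ring.
  apply Rmult_le_compat; auto using Rabs_pos.
Qed.

Lemma bigO_const (T c : R) : bigO T 0 (fun _ => c).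
Proof.
  exists (Rabs c). split; [apply Rabs_pos|]. intros s Hs. simpl. lra.
Qed.

Lemma bigO_pow (T : R) (m : Z) (n : nat) (f : R -> R) :
  1 <= T -> bigO T m f -> bigO T (m * Z.of_nat n) (fun s => f s ^ n).
Proof.
  intros HT Hf. induction n as [|n IH].
  - replace (m * Z.of_nat 0)%Z with 0%Z by lia. apply (bigO_const T 1).
  - replace (m * Z.of_nat (S n))%Z with (m + m * Z.of_nat n)%Z by lia.
    apply (bigO_mult T m _ f (fun s => f s ^ n)); assumption.
Qed.

Lemma bigO_id (T : R) : 0 <= T -> bigO T 1 (fun s => s).
Proof.
  intros HT. exists 1. split; [lra|]. intros s Hs. rewrite powerRZ_1, Rabs_right; lra.
Qed.

Lemma bigO_inv_1_sqr (T e : R) : 1 <= T -> e^2 = 1 ->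
  bigO T (-2) (fun s => / (1 + (e * s)^2)).
Proof.
  intros HT He. exists 1. split; [lra|]. intros s Hs.
  replace ((e * s)^2) with (s^2) by (rewrite Rpow_mult_distr, He; ring).
  rewrite Rabs_right.
  - simpl. rewrite Rmult_1_l. apply Rinv_le_contravar; nra.
  - apply Rle_ge. left. apply Rinv_0_lt_compat. nra.
Qed.

Lemma sign_sqr (e : R) : e = 1 \/ e = -1 -> e^2 = 1.
Proof. intros [-> | ->]; ring. Qed.

(** Dividing the forcing by [P], of order at least [s^2], gains two powers. The sign [e] selects the
    end of the line: for [e = 1] the linear term damps, while for [e = -1], with [s = -t], it repels
    and the bounded antiderivative [Y] takes over. *)
Lemma bigO_decay (e : R) (m : nat) (n : Z) (Y y f P : R -> R) (T : R) :
  e = 1 \/ e = -1 -> 1 <= T -> 12 * INR (S m) <= T ->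
  (forall s, T <= s -> is_derive Y s (y s)) ->
  bigO T 0 Y ->
  (forall s, T <= s -> is_derive y s (- (e * P s) * y s + f s)) ->
  (forall s, T <= s -> s^2 / 6 <= P s) ->
  n = (1 - Z.of_nat m)%Z -> bigO T n f ->
  bigO T (n - 2) y.
Proof.
  intros He HT Hm HY [B [HB HYB]] Hy HP Hn [C [HC Hf]].
  assert (HfC : forall s, T <= s -> Rabs (f s) * s^(S m) <= C * s^2).
  { intros s Hs. apply Rle_trans with (C * powerRZ s n * s^(S m)).
    - apply Rmult_le_compat_r; [apply pow_le; lra|auto].
    - right. rewrite !pow_powerRZ, Rmult_assoc, <- powerRZ_add by lra.
      repeat f_equal. lia. }
  assert (HK : exists K, forall s, T <= s -> Rabs (y s) * s^(S m) <= K).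
  { destruct He as [-> | ->].
    - apply (decay_stable m y f P T C); auto.
      intros s Hs. specialize (Hy s Hs). rewrite Rmult_1_l in Hy. exact Hy.
    - exists (6 * C). apply (decay_unstable (S m) Y y f P T B C); auto.
      + intros s Hs. specialize (HYB s Hs). simpl in HYB. lra.
      + intros s Hs. specialize (Hy s Hs).
        replace (P s) with (- (-1 * P s)) by ring. exact Hy. }
  destruct HK as [K HK]. exists (Rabs K). split; [apply Rabs_pos|].
  intros s Hs. specialize (HK s Hs).
  assert (Hp : 0 < s^(S m)) by (apply pow_lt; lra).
  apply Rmult_le_reg_r with (s^(S m)); [exact Hp|].
  replace (Rabs K * powerRZ s (n - 2) * s^(S m)) with (Rabs K).
  - apply Rle_trans with (1 := HK), Rle_abs.
  - rewrite pow_powerRZ, Rmult_assoc, <- powerRZ_add by lra.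
    replace (n - 2 + Z.of_nat (S m))%Z with 0%Z by lia. simpl. ring.
Qed.

(** The order of a product is synthesised by unification as the sum of the orders of its factors.
    [bigO_solve] splits sums beforehand, so that each monomial is weakened on its own to the target
    order by [lia]. *)
Ltac bigO_mono :=
  lazymatch goal with
  | H : bigO _ _ ?f |- bigO _ _ ?f => exact H
  | |- bigO _ _ (fun _ => ?c) => apply (bigO_const _ c)
  | |- bigO _ _ (fun s => - _) => apply bigO_opp; bigO_mono
  | |- bigO _ _ (fun s => _ * _) => eapply bigO_mult; [assumption|bigO_mono|bigO_mono]
  | |- bigO _ _ (fun s => _ / _) =>
      unfold Rdiv; eapply bigO_mult; [assumption|bigO_mono|bigO_mono]
  | |- bigO _ _ (fun s => _ ^ _) => eapply bigO_pow; [assumption|bigO_mono]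
  | |- bigO _ _ (fun s => / _) => apply bigO_inv_1_sqr; [assumption|assumption]
  | |- bigO _ _ (fun s => s) => apply bigO_id; lra
  | |- bigO _ _ (Rmult ?c) =>
      eapply (bigO_mult _ _ _ (fun _ => c) (fun s => s)); [assumption|bigO_mono|bigO_mono]
  end.

Ltac bigO_solve :=
  lazymatch goal with
  | |- bigO _ _ (fun s => _ + _) => apply bigO_plus; bigO_solve
  | |- bigO _ _ (fun s => _ - _) => apply bigO_minus; bigO_solve
  | |- _ => eapply bigO_weaken; [assumption|bigO_mono|lia]
  end.

(** Differentiating the equation keeps the linear part [- e P y], and the forcing terms have orders
    -1, -2, -3 in turn; two powers gained each time give -3, -4, -5. Each derivative has the
    preceding one as bounded antiderivative. The threshold 60 is [12 * INR (S m)] for the last use,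
    [m = 4]. *)
Lemma bigO_bootstrap (e : R) (g g1 g2 g3 P P1 P2 Q Q1 Q2 : R -> R) (T : R) :
  e = 1 \/ e = -1 -> 60 <= T ->
  (forall s, T <= s -> is_derive g s (g1 s)) ->
  (forall s, T <= s -> is_derive g1 s (g2 s)) ->
  (forall s, T <= s -> is_derive g2 s (g3 s)) ->
  (forall s, T <= s -> g2 s = - (e * P s) * g1 s + - (Q s * g s)) ->
  (forall s, T <= s -> g3 s = - (e * P s) * g2 s
     + (- (e * P1 s * g1 s) - Q s * g1 s - Q1 s * g s)) ->
  (forall s, T <= s -> is_derive g3 s (- (e * P s) * g3 s
     + (- (2 * e * P1 s * g2 s) - Q s * g2 s - e * P2 s * g1 s
        - 2 * Q1 s * g1 s - Q2 s * g s))) ->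
  (forall s, T <= s -> s^2 / 6 <= P s) ->
  bigO T 1 P1 -> bigO T 0 P2 -> bigO T (-1) Q -> bigO T (-2) Q1 -> bigO T (-3) Q2 ->
  bigO T 0 g ->
  bigO T (-3) g1 /\ bigO T (-4) g2 /\ bigO T (-5) g3.
Proof.
  intros He HT Hg Hg1 Hg2 E2 E3 Hg3 HP HP1 HP2 HQ HQ1 HQ2 HB.
  assert (HT1 : 1 <= T) by lra.
  assert (H1 : bigO T (-3) g1).
  { apply (bigO_decay e 2 (-1) g g1 (fun s => - (Q s * g s)) P T); auto.
    - simpl; lra.
    - intros s Hs. rewrite <- E2 by exact Hs. auto.
    - bigO_solve. }
  assert (H2 : bigO T (-4) g2).
  { apply (bigO_decay e 3 (-2) g1 g2
      (fun s => - (e * P1 s * g1 s) - Q s * g1 s - Q1 s * g s) P T); auto.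
    - simpl; lra.
    - apply bigO_weaken with (-3)%Z; auto; lia.
    - intros s Hs. rewrite <- E3 by exact Hs. auto.
    - bigO_solve. }
  split; [exact H1|split; [exact H2|]].
  apply (bigO_decay e 4 (-3) g2 g3
      (fun s => - (2 * e * P1 s * g2 s) - Q s * g2 s - e * P2 s * g1 s
        - 2 * Q1 s * g1 s - Q2 s * g s) P T); auto.
  - simpl; lra.
  - apply bigO_weaken with (-4)%Z; auto; lia.
  - bigO_solve.
Qed.

(** * The weighted equation *)

Section WeightedEquation.

Variables a mu : R.

(** With [p = 2 mu t / (1 + t^2)], the logarithmic derivative of the weight, [drift = t^2/3 - 2 p]
    and [pot = a t - p t^2/3 + p^2 - p']; in [pot] the choice [mu = 3a/2] has already merged the
    first two terms into [a t / (1 + t^2)]. All formulas are written in monomials in [t] and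
    [/ (1 + t^2)], the shape that [bigO_mono] reads. *)
Definition drift (t : R) : R := t^2 * / 3 - 4 * mu * t * / (1 + t^2).
Definition drift1 (t : R) : R := 2 * / 3 * t - 4 * mu * / (1 + t^2) + 8 * mu * t^2 * (/ (1 + t^2))^2.
Definition drift2 (t : R) : R := 2 * / 3 + 24 * mu * t * (/ (1 + t^2))^2 - 32 * mu * t^3 * (/ (1 + t^2))^3.
Definition pot (t : R) : R := a * t * / (1 + t^2) - 2 * mu * / (1 + t^2)
  + 4 * mu * (mu + 1) * t^2 * (/ (1 + t^2))^2.
Definition pot1 (t : R) : R := a * / (1 + t^2) - 2 * a * t^2 * (/ (1 + t^2))^2
  + 4 * mu * t * (/ (1 + t^2))^2
  + 4 * mu * (mu + 1) * (2 * t * (/ (1 + t^2))^2 - 4 * t^3 * (/ (1 + t^2))^3).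
Definition pot2 (t : R) : R := - (6 * a * t * (/ (1 + t^2))^2) + 8 * a * t^3 * (/ (1 + t^2))^3
  + 4 * mu * (/ (1 + t^2))^2 - 16 * mu * t^2 * (/ (1 + t^2))^3
  + 4 * mu * (mu + 1) * (2 * (/ (1 + t^2))^2)
  - 4 * mu * (mu + 1) * (20 * t^2 * (/ (1 + t^2))^3)
  + 4 * mu * (mu + 1) * (24 * t^4 * (/ (1 + t^2))^4).

Lemma one_plus_sqr_neq0 (t : R) : 1 + t^2 <> 0.
Proof. nra. Qed.

Lemma is_derive_drift (t : R) : is_derive drift t (drift1 t).
Proof.
  pose proof (one_plus_sqr_neq0 t). unfold drift, drift1.
  auto_derive; [simpl in *; lra|]. field. simpl in *; lra.
Qed.

Lemma is_derive_drift1 (t : R) : is_derive drift1 t (drift2 t).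
Proof.
  pose proof (one_plus_sqr_neq0 t). unfold drift1, drift2.
  auto_derive; [simpl in *; lra|]. field. simpl in *; lra.
Qed.

Lemma is_derive_pot (t : R) : is_derive pot t (pot1 t).
Proof.
  pose proof (one_plus_sqr_neq0 t). unfold pot, pot1.
  auto_derive; [simpl in *; lra|]. field. simpl in *; lra.
Qed.

Lemma is_derive_pot1 (t : R) : is_derive pot1 t (pot2 t).
Proof.
  pose proof (one_plus_sqr_neq0 t). unfold pot1, pot2.
  auto_derive; [simpl in *; lra|]. field. simpl in *; lra.
Qed.

Lemma coefficient_bounds (e T : R) : e^2 = 1 -> 1 <= T ->
  bigO T 1 (fun s => drift1 (e * s)) /\ bigO T 0 (fun s => drift2 (e * s)) /\
  bigO T (-1) (fun s => pot (e * s)) /\ bigO T (-2) (fun s => pot1 (e * s)) /\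
  bigO T (-3) (fun s => pot2 (e * s)).
Proof.
  intros He HT. unfold drift1, drift2, pot, pot1, pot2.
  split; [bigO_solve|]. split; [bigO_solve|]. split; [bigO_solve|].
  split; [|bigO_solve].
  (* The last term of [pot1] is a constant times a difference, not a monomial, so its product is
     split by hand. *)
  apply bigO_plus; [bigO_solve|].
  eapply bigO_weaken; [assumption| |].
  - apply (bigO_mult T 0 (-2)); [assumption|apply bigO_const|bigO_solve].
  - lia.
Qed.

Lemma drift_lower_bound (e s : R) : e^2 = 1 -> 1 <= s -> 24 * Rabs mu <= s ->
  s^2 / 6 <= drift (e * s).
Proof.
  intros He Hs Hmu. unfold drift.
  replace ((e * s)^2) with (s^2) by (rewrite Rpow_mult_distr, He; ring).
  assert (Hes : Rabs (e * s) <= s).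
  { rewrite Rabs_mult, (Rabs_right s) by lra.
    assert (Rabs e <= 1); [|nra].
    rewrite <- pow2_abs in He. pose proof (Rabs_pos e). nra. }
  assert (4 * mu * (e * s) * / (1 + s^2) <= s^2 / 6); [|lra].
  apply Rle_trans with (Rabs (4 * mu * (e * s) * / (1 + s^2))); [apply Rle_abs|].
  rewrite !Rabs_mult, (Rabs_right 4), <- (Rabs_mult e) by lra.
  rewrite (Rabs_right (/ (1 + s^2))).
  2:{ apply Rle_ge. left. apply Rinv_0_lt_compat. nra. }
  pose proof (Rabs_pos mu).
  apply Rle_trans with (4 * Rabs mu * s * / s).
  - apply Rmult_le_compat.
    + pose proof (Rabs_pos (e * s)). apply Rmult_le_pos; lra.
    + left. apply Rinv_0_lt_compat. nra.
    + apply Rmult_le_compat_l; lra.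
    + apply Rinv_le_contravar; nra.
  - rewrite Rmult_assoc, Rinv_r by lra. nra.
Qed.

Section Solution.

Variables F F1 : R -> R.
Hypothesis HF : forall t, is_derive F t (F1 t).
Hypothesis HF1 : forall t, is_derive F1 t (- (t^2 / 3) * F1 t - a * t * F t).
Hypothesis Hmu : mu = 3 * a / 2.

Definition wsol (t : R) : R := Rpower (1 + t^2) mu * F t.
Definition wsol1 (t : R) : R := Rpower (1 + t^2) mu * (F1 t + 2 * mu * t * / (1 + t^2) * F t).
(** Defined through the equation instead of by differentiating [wsol1], so that [wsol3] and [wsol4]
    come out in the form [- drift * y + f] used by the bootstrap. *)
Definition wsol2 (t : R) : R := - drift t * wsol1 t - pot t * wsol t.
Definition wsol3 (t : R) : R := - drift t * wsol2 t + (- (drift1 t * wsol1 t) - pot t * wsol1 t - pot1 t * wsol t).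
Definition wsol4 (t : R) : R := - drift t * wsol3 t + (- (2 * drift1 t * wsol2 t) - pot t * wsol2 t - drift2 t * wsol1 t
   - 2 * pot1 t * wsol1 t - pot2 t * wsol t).

Lemma is_derive_weight (t : R) :
  is_derive (fun t => Rpower (1 + t^2) mu) t
    (2 * mu * t * / (1 + t^2) * Rpower (1 + t^2) mu).
Proof.
  unfold Rpower. assert (0 < 1 + t^2) by nra.
  auto_derive; [simpl in *; lra|].
  replace (1 + t * (t * 1)) with (1 + t^2) by ring. field. lra.
Qed.

Lemma is_derive_wsol (t : R) : is_derive wsol t (wsol1 t).
Proof.
  unfold wsol, wsol1. evar_last.
  - apply (is_derive_mult (fun t => Rpower (1 + t^2) mu) F).
    + apply is_derive_weight.
    + apply HF.
    + intros; apply Rmult_comm.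
  - cbv [plus mult]; simpl. ring.
Qed.

(** The weighted equation itself. The relation [a = 2 mu / 3] is what cancels the part of the
    zeroth-order coefficient that grows like [t]. *)
Lemma is_derive_wsol1 (t : R) : is_derive wsol1 t (wsol2 t).
Proof.
  pose proof (one_plus_sqr_neq0 t).
  unfold wsol1. evar_last.
  - apply (is_derive_mult (fun t => Rpower (1 + t^2) mu)
      (fun t => F1 t + 2 * mu * t * / (1 + t^2) * F t)).
    + apply is_derive_weight.
    + apply (is_derive_plus (V := R_NormedModule) F1).
      * apply HF1.
      * apply (is_derive_mult (fun t => 2 * mu * t * / (1 + t^2)) F).
        -- auto_derive; [simpl in *; lra|reflexivity].
        -- apply HF.
        -- intros; apply Rmult_comm.
    + intros; apply Rmult_comm.
  - unfold wsol2, wsol1, wsol, drift, pot. cbv [plus mult]; simpl.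
    replace a with (2 * mu / 3) by (rewrite Hmu; field).
    field. simpl in *; lra.
Qed.

Lemma is_derive_wsol2 (t : R) : is_derive wsol2 t (wsol3 t).
Proof.
  unfold wsol2. evar_last.
  - apply (is_derive_minus (V := R_NormedModule)
      (fun t => - drift t * wsol1 t) (fun t => pot t * wsol t)).
    + apply (is_derive_mult (fun t => - drift t) wsol1).
      * apply (is_derive_opp (V := R_NormedModule) drift), is_derive_drift.
      * apply is_derive_wsol1.
      * intros; apply Rmult_comm.
    + apply (is_derive_mult pot wsol).
      * apply is_derive_pot.
      * apply is_derive_wsol.
      * intros; apply Rmult_comm.
  - unfold wsol3. cbv [plus minus opp mult]; simpl. ring.
Qed.

Lemma is_derive_wsol3 (t : R) : is_derive wsol3 t (wsol4 t).
Proof.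
  unfold wsol3. evar_last.
  - apply (is_derive_plus (V := R_NormedModule) (fun t => - drift t * wsol2 t)
      (fun t => - (drift1 t * wsol1 t) - pot t * wsol1 t - pot1 t * wsol t)).
    + apply (is_derive_mult (fun t => - drift t) wsol2).
      * apply (is_derive_opp (V := R_NormedModule) drift), is_derive_drift.
      * apply is_derive_wsol2.
      * intros; apply Rmult_comm.
    + apply (is_derive_minus (V := R_NormedModule)
        (fun t => - (drift1 t * wsol1 t) - pot t * wsol1 t) (fun t => pot1 t * wsol t)).
      * apply (is_derive_minus (V := R_NormedModule)
          (fun t => - (drift1 t * wsol1 t)) (fun t => pot t * wsol1 t)).
        -- apply (is_derive_opp (V := R_NormedModule) (fun t => drift1 t * wsol1 t)).
           apply (is_derive_mult drift1 wsol1).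
           ++ apply is_derive_drift1.
           ++ apply is_derive_wsol1.
           ++ intros; apply Rmult_comm.
        -- apply (is_derive_mult pot wsol1).
           ++ apply is_derive_pot.
           ++ apply is_derive_wsol1.
           ++ intros; apply Rmult_comm.
      * apply (is_derive_mult pot1 wsol).
        -- apply is_derive_pot1.
        -- apply is_derive_wsol.
        -- intros; apply Rmult_comm.
  - unfold wsol4, wsol3. cbv [plus minus opp mult]; simpl. ring.
Qed.

(** The substitution [t = e * s] brings both ends to [s -> +oo]. Derivatives of odd order, of the
    solution and of the coefficients, then carry a factor [e], removed by [e^2 = 1]. *)
Lemma wsol_end_bounds (e T : R) :
  e = 1 \/ e = -1 -> 60 <= T -> 24 * Rabs mu <= T ->
  bigO T 0 (fun s => wsol (e * s)) ->
  bigO T (-3) (fun s => wsol1 (e * s)) /\ bigO T (-4) (fun s => wsol2 (e * s)) /\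
  bigO T (-5) (fun s => wsol3 (e * s)).
Proof.
  intros He HT HTmu HB.
  assert (He2 : e^2 = 1) by (apply sign_sqr, He).
  assert (HT1 : 1 <= T) by lra.
  assert (Hlin : forall f f' s, is_derive f (e * s) f' ->
     is_derive (fun s => f (e * s)) s (e * f')).
  { intros f f' s Hf. evar_last.
    - apply (is_derive_comp f (fun s => e * s)); [exact Hf|].
      apply is_derive_scal. apply (@is_derive_id R_AbsRing).
    - cbv [scal one]; simpl. cbv [mult]; simpl. ring. }
  destruct (coefficient_bounds e T He2 HT1) as [O1 [O2 [O3 [O4 O5]]]].
  destruct (bigO_bootstrap e (fun s => wsol (e * s)) (fun s => e * wsol1 (e * s))
    (fun s => wsol2 (e * s)) (fun s => e * wsol3 (e * s))
    (fun s => drift (e * s)) (fun s => e * drift1 (e * s)) (fun s => drift2 (e * s))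
    (fun s => pot (e * s)) (fun s => e * pot1 (e * s)) (fun s => pot2 (e * s)) T)
    as [H1 [H2 H3]]; auto.
  - intros s Hs. apply Hlin, is_derive_wsol.
  - intros s Hs. evar_last.
    + apply is_derive_scal, Hlin, is_derive_wsol1.
    + transitivity (e^2 * wsol2 (e * s)); [ring|rewrite He2; ring].
  - intros s Hs. apply Hlin, is_derive_wsol2.
  - intros s Hs. unfold wsol2 at 1.
    transitivity (- (e^2 * drift (e * s)) * wsol1 (e * s) - pot (e * s) * wsol (e * s));
      [rewrite He2; ring|ring].
  - intros s Hs. unfold wsol3 at 1.
    transitivity (- (e * drift (e * s)) * wsol2 (e * s)
      + (- (e * (e^2) * drift1 (e * s) * wsol1 (e * s)) - pot (e * s) * (e * wsol1 (e * s))
      - e * pot1 (e * s) * wsol (e * s))); [rewrite He2; ring|ring].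
  - intros s Hs. evar_last.
    + apply is_derive_scal, Hlin, is_derive_wsol3.
    + transitivity (e^2 * wsol4 (e * s)); [ring|]. unfold wsol4.
      transitivity (- (e^2 * drift (e * s)) * wsol3 (e * s)
       + (- (2 * e^2 * drift1 (e * s) * wsol2 (e * s)) - pot (e * s) * wsol2 (e * s)
       - e^2 * drift2 (e * s) * wsol1 (e * s) - 2 * (e^2 * pot1 (e * s)) * wsol1 (e * s)
       - pot2 (e * s) * wsol (e * s))); [rewrite He2; ring|ring].
  - intros s Hs. apply drift_lower_bound; lra.
  - apply (bigO_mult T 0 1 (fun _ => e)); auto. apply bigO_const.
  - apply (bigO_mult T 0 (-2) (fun _ => e)); auto. apply bigO_const.
  - split; [|split; [exact H2|]].
    + apply bigO_ext with (fun s => e * (e * wsol1 (e * s))).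
      * intros s Hs. rewrite <- Rmult_assoc. replace (e * e) with (e^2) by ring.
        rewrite He2. ring.
      * apply (bigO_mult T 0 (-3) (fun _ => e)); auto. apply bigO_const.
    + apply bigO_ext with (fun s => e * (e * wsol3 (e * s))).
      * intros s Hs. rewrite <- Rmult_assoc. replace (e * e) with (e^2) by ring.
        rewrite He2. ring.
      * apply (bigO_mult T 0 (-5) (fun _ => e)); auto. apply bigO_const.
Qed.

Definition weighted_sum (t : R) : R :=
  Rabs (wsol t) + Rabs (t^3 * wsol1 t) + Rabs (t^4 * wsol2 t) + Rabs (t^5 * wsol3 t).

Lemma weighted_sum_end (e T : R) :
  e = 1 \/ e = -1 -> 60 <= T -> 24 * Rabs mu <= T ->
  bigO T 0 (fun s => wsol (e * s)) ->
  exists K, forall s, T <= s -> weighted_sum (e * s) <= K.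
Proof.
  intros He HT HTmu HB.
  destruct (wsol_end_bounds e T He HT HTmu HB) as [[K1 [_ H1]] [[K2 [_ H2]] [K3 [_ H3]]]].
  destruct HB as [K0 [_ H0]].
  exists (K0 + K1 + K2 + K3). intros s Hs.
  assert (Hes : Rabs (e * s) = s).
  { destruct He as [-> | ->]; rewrite Rabs_mult, (Rabs_right s) by lra.
    - rewrite Rabs_R1. ring.
    - rewrite Rabs_m1. ring. }
  assert (Hscale : forall (f : R) (K : R) (n : nat),
    Rabs f <= K * powerRZ s (- Z.of_nat n) -> Rabs ((e * s)^n * f) <= K).
  { intros f K n Hf. rewrite Rabs_mult, <- RPow_abs, Hes.
    apply Rle_trans with (s^n * (K * powerRZ s (- Z.of_nat n))).
    - apply Rmult_le_compat_l; [apply pow_le; lra|exact Hf].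
    - right. rewrite pow_powerRZ.
      transitivity (K * (powerRZ s (Z.of_nat n) * powerRZ s (- Z.of_nat n))); [ring|].
      rewrite <- powerRZ_add by lra.
      replace (Z.of_nat n + - Z.of_nat n)%Z with 0%Z by lia. simpl. ring. }
  unfold weighted_sum.
  specialize (H0 s Hs). simpl in H0. rewrite Rmult_1_r in H0.
  pose proof (Hscale _ _ 3%nat (H1 s Hs)).
  pose proof (Hscale _ _ 4%nat (H2 s Hs)).
  pose proof (Hscale _ _ 5%nat (H3 s Hs)).
  lra.
Qed.

Lemma continuous_of_is_derive (f : R -> R) (t l : R) : is_derive f t l -> continuous f t.
Proof. intros H. apply (ex_derive_continuous f). exists l. exact H. Qed.

Lemma weighted_sum_continuous (t : R) : continuous weighted_sum t.
Proof.
  assert (Habs : forall f : R -> R, continuous f t -> continuous (fun t => Rabs (f t)) t).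
  { intros f Hf. apply (continuous_comp f Rabs); [exact Hf|apply continuous_Rabs]. }
  assert (Hpow : forall (n : nat), continuous (fun t => t^n) t).
  { intros n. apply (ex_derive_continuous (fun t => t^n)). auto_derive. exact I. }
  assert (Hterm : forall (n : nat) (f f' : R -> R), (forall t, is_derive f t (f' t)) ->
    continuous (fun t => Rabs (t^n * f t)) t).
  { intros n f f' Hf. apply Habs. apply (continuous_mult (K := R_AbsRing)).
    - apply Hpow.
    - apply continuous_of_is_derive with (1 := Hf t). }
  apply (continuous_plus (V := R_NormedModule)
    (fun t => Rabs (wsol t) + Rabs (t^3 * wsol1 t) + Rabs (t^4 * wsol2 t))
    (fun t => Rabs (t^5 * wsol3 t))); [|apply (Hterm 5%nat wsol3 wsol4 is_derive_wsol3)].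
  apply (continuous_plus (V := R_NormedModule)
    (fun t => Rabs (wsol t) + Rabs (t^3 * wsol1 t))
    (fun t => Rabs (t^4 * wsol2 t))); [|apply (Hterm 4%nat wsol2 wsol3 is_derive_wsol2)].
  apply (continuous_plus (V := R_NormedModule)
    (fun t => Rabs (wsol t))
    (fun t => Rabs (t^3 * wsol1 t))); [|apply (Hterm 3%nat wsol1 wsol2 is_derive_wsol1)].
  apply Habs, continuous_of_is_derive with (1 := is_derive_wsol t).
Qed.

Lemma weighted_sum_bounded (T : R) :
  60 <= T -> 24 * Rabs mu <= T ->
  bigO T 0 (fun s => wsol (1 * s)) -> bigO T 0 (fun s => wsol (-1 * s)) ->
  exists K, forall t, weighted_sum t <= K.
Proof.
  intros HT HTmu Hp Hn.
  destruct (weighted_sum_end 1 T (or_introl eq_refl) HT HTmu Hp) as [Kp HKp].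
  destruct (weighted_sum_end (-1) T (or_intror eq_refl) HT HTmu Hn) as [Kn HKn].
  destruct (continuity_ab_maj weighted_sum (-T) T) as [x [Hx _]].
  - lra.
  - intros c _. apply continuity_pt_filterlim, weighted_sum_continuous.
  - exists (Rmax Kp (Rmax Kn (weighted_sum x))). intros t.
    destruct (Rle_lt_dec T t) as [Ht|Ht].
    + apply Rle_trans with Kp; [|apply Rmax_l].
      replace t with (1 * t) by ring. auto.
    + destruct (Rle_lt_dec t (-T)) as [Ht'|Ht'].
      * apply Rle_trans with Kn.
        -- replace t with (-1 * - t) by ring. apply HKn. lra.
        -- apply Rle_trans with (2 := Rmax_r _ _), Rmax_l.
      * apply Rle_trans with (weighted_sum x).
        -- apply Hx. lra.
        -- apply Rle_trans with (2 := Rmax_r _ _), Rmax_r.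
Qed.

Lemma wsol_bounded_pos (T : R) :
  1 <= T -> 24 * Rabs mu <= T -> bigO T 0 (fun s => wsol (1 * s)).
Proof.
  intros HT HTmu.
  destruct (coefficient_bounds 1 T ltac:(ring) HT) as [_ [_ [[C [HC HQ]] _]]].
  destruct (bounded_stable wsol wsol1 drift pot T C) as [B HB]; auto.
  - intros s _. apply is_derive_wsol.
  - intros s _. apply is_derive_wsol1.
  - intros s Hs. rewrite <- (Rmult_1_l s) at 2. apply drift_lower_bound; lra.
  - intros s Hs. specialize (HQ s Hs). rewrite Rmult_1_l in HQ.
    apply Rle_trans with (C * powerRZ s (-1) * s).
    + apply Rmult_le_compat_r; lra.
    + right. simpl. field. lra.
  - exists (Rabs B). split; [apply Rabs_pos|]. intros s Hs.
    rewrite Rmult_1_l. simpl. rewrite Rmult_1_r.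
    apply Rle_trans with (1 := HB s Hs), Rle_abs.
Qed.

End Solution.

(** The substitution [s = -t] turns damping into growth, [g1' = P g1 - Q g]. The common weight drops
    out of the ratio, so smallness is asked of the unweighted [F] and [D], whereas the growth of [D]
    is asked with the weight. The threshold is left open upwards in order to merge with the
    others. *)
Lemma wsol_bounded_neg (F F1 D D1 : R -> R) :
  mu = 3 * a / 2 ->
  (forall t, is_derive F t (F1 t)) ->
  (forall t, is_derive F1 t (- (t^2 / 3) * F1 t - a * t * F t)) ->
  (forall t, is_derive D t (D1 t)) ->
  (forall t, is_derive D1 t (- (t^2 / 3) * D1 t - a * t * D t)) ->
  (forall eps M, 0 < eps -> exists s, M <= s /\ M <= Rabs (wsol D (- s)) /\
     Rabs (F (- s)) <= eps * Rabs (D (- s))) ->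
  exists T, forall T', T <= T' -> bigO T' 0 (fun s => wsol F (-1 * s)).
Proof.
  intros Hmu HF HF1 HD HD1 Hsmall.
  destruct (coefficient_bounds (-1) 1 ltac:(ring) (Rle_refl 1)) as [_ [_ [[C [HC HQ]] _]]].
  set (T := Rmax (Rmax 6 (24 * Rabs mu)) (6 * (C + 1)^2)).
  assert (HT6 : 6 <= T)
    by (apply Rle_trans with (2 := Rmax_l _ _), Rmax_l).
  assert (HTmu : 24 * Rabs mu <= T)
    by (apply Rle_trans with (2 := Rmax_l _ _), Rmax_r).
  assert (HTC : 6 * (C + 1)^2 <= T) by apply Rmax_r.
  assert (Hneg : forall f f' s, is_derive f (- s) f' ->
     is_derive (fun s => f (- s)) s (- f')).
  { intros f f' s Hf. evar_last.
    - apply (is_derive_comp f (fun s => - s)); [exact Hf|].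
      apply (is_derive_opp (V := R_NormedModule) (fun s => s)).
      apply (@is_derive_id R_AbsRing).
    - cbv [scal opp one]; simpl. cbv [mult]; simpl. ring. }
  assert (Hsys : forall H H1 : R -> R, (forall t, is_derive H t (H1 t)) ->
     (forall t, is_derive H1 t (- (t^2 / 3) * H1 t - a * t * H t)) ->
     (forall s, is_derive (fun s => wsol H (- s)) s (- wsol1 H H1 (- s))) /\
     (forall s, is_derive (fun s => - wsol1 H H1 (- s)) s
        (drift (- s) * - wsol1 H H1 (- s) - pot (- s) * wsol H (- s)))).
  { intros H H1 HH HH1. split; intros s.
    - apply Hneg, is_derive_wsol, HH.
    - evar_last.
      + apply (is_derive_opp (V := R_NormedModule) (fun s => wsol1 H H1 (- s))).
        apply Hneg, is_derive_wsol1; assumption.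
      + cbv [opp]; simpl. unfold wsol2. ring. }
  destruct (Hsys F F1 HF HF1) as [S1 S2]. destruct (Hsys D D1 HD HD1) as [S3 S4].
  destruct (bounded_unstable (fun s => wsol F (- s)) (fun s => - wsol1 F F1 (- s))
    (fun s => wsol D (- s)) (fun s => - wsol1 D D1 (- s))
    (fun s => drift (- s)) (fun s => pot (- s)) T C) as [B HB]; auto.
  - intros s Hs. replace (- s) with (-1 * s) by ring. apply drift_lower_bound; [ring|lra|lra].
  - intros s Hs. specialize (HQ s ltac:(lra)). replace (- s) with (-1 * s) by ring.
    apply Rle_trans with (C * powerRZ s (-1) * s).
    + apply Rmult_le_compat_r; lra.
    + right. simpl. field. lra.
  - intros eps M Heps. destruct (Hsmall eps M Heps) as [s [H1 [H2 H3]]].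
    exists s. split; [exact H1|split; [exact H2|]].
    unfold wsol. rewrite !Rabs_mult.
    set (p := Rabs (Rpower (1 + (- s)^2) mu)).
    replace (eps * (p * Rabs (D (- s)))) with (p * (eps * Rabs (D (- s)))) by ring.
    apply Rmult_le_compat_l; [apply Rabs_pos|exact H3].
  - exists T. intros T' HT'.
    exists (Rabs B). split; [apply Rabs_pos|]. intros s Hs.
    replace (-1 * s) with (- s) by ring. simpl. rewrite Rmult_1_r.
    apply Rle_trans with (1 := HB s ltac:(lra)), Rle_abs.
Qed.

End WeightedEquation.

Lemma weighted_solution_bounded (a mu : R) (F F1 D D1 : R -> R) :
  mu = 3 * a / 2 ->
  (forall t, is_derive F t (F1 t)) ->
  (forall t, is_derive F1 t (- (t^2 / 3) * F1 t - a * t * F t)) ->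
  (forall t, is_derive D t (D1 t)) ->
  (forall t, is_derive D1 t (- (t^2 / 3) * D1 t - a * t * D t)) ->
  (forall eps M, 0 < eps -> exists s, M <= s /\
     M <= Rabs (Rpower (1 + (- s)^2) mu * D (- s)) /\
     Rabs (F (- s)) <= eps * Rabs (D (- s))) ->
  exists G1 G2 G3 : R -> R,
    (forall t, is_derive (fun t => Rpower (1 + t^2) mu * F t) t (G1 t)) /\
    (forall t, is_derive G1 t (G2 t)) /\
    (forall t, is_derive G2 t (G3 t)) /\
    exists K, forall t, Rabs (Rpower (1 + t^2) mu * F t) + Rabs (t^3 * G1 t)
      + Rabs (t^4 * G2 t) + Rabs (t^5 * G3 t) <= K.
Proof.
  intros Hmu HF HF1 HD HD1 Hsmall.
  exists (wsol1 mu F F1), (wsol2 a mu F F1), (wsol3 a mu F F1).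
  split; [intros t; apply is_derive_wsol, HF|].
  split; [intros t; apply is_derive_wsol1; assumption|].
  split; [intros t; apply is_derive_wsol2; assumption|].
  destruct (wsol_bounded_neg a mu F F1 D D1 Hmu HF HF1 HD HD1 Hsmall) as [T0 HT0].
  set (T := Rmax (Rmax 60 (24 * Rabs mu)) T0).
  assert (HT60 : 60 <= T)
    by (apply Rle_trans with (2 := Rmax_l _ _), Rmax_l).
  assert (HTmu : 24 * Rabs mu <= T)
    by (apply Rle_trans with (2 := Rmax_l _ _), Rmax_r).
  apply (weighted_sum_bounded a mu F F1 HF HF1 Hmu T HT60 HTmu).
  - apply (wsol_bounded_pos a mu F F1 HF HF1 Hmu); lra.
  - apply HT0. apply Rmax_r.
Qed.

(** * Power series with positive coefficients at infinity *)

Lemma ex_series_Rscal (c : R) (u : nat -> R) :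
  ex_series u -> ex_series (fun n => c * u n).
Proof. apply (ex_series_scal (V := R_NormedModule) c u). Qed.

Lemma ex_series_Rplus (u v : nat -> R) :
  ex_series u -> ex_series v -> ex_series (fun n => u n + v n).
Proof. apply (ex_series_plus (V := R_NormedModule) u v). Qed.

Lemma Series_ge0 (u : nat -> R) : (forall n, 0 <= u n) -> ex_series u -> 0 <= Series u.
Proof.
  intros Hu Hex. rewrite <- (Rmult_0_l (Series u)), <- Series_scal_l.
  apply Series_le; [|exact Hex]. intros n. specialize (Hu n). lra.
Qed.

Lemma finite_prefix_bound (q e : nat -> R) :
  (forall n, 0 < e n) ->
  forall N, exists C, 0 <= C /\ forall n, (n < N)%nat -> Rabs (q n) <= C * e (S n).
Proof.
  intros He N. induction N as [|N [C [HC IH]]].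
  - exists 0. split; [lra|]. intros n Hn. lia.
  - exists (C + Rabs (q N) / e (S N)).
    assert (0 <= Rabs (q N) / e (S N)).
    { apply Rdiv_le_0_compat; [apply Rabs_pos|apply He]. }
    split; [lra|]. intros n Hn. pose proof (He (S n)).
    destruct (Nat.eq_dec n N) as [->|Hne].
    + replace ((C + Rabs (q N) / e (S N)) * e (S N))
        with (C * e (S N) + Rabs (q N)) by (field; lra). nra.
    + specialize (IH n ltac:(lia)). nra.
Qed.

(* The finitely many [n] where [q n / e n] is not yet small are absorbed by the
   next coefficient [e (S n)], at the price of a factor [1 / x]. *)
Lemma series_negligible (q e : nat -> R) :
  (forall n, 0 < e n) ->
  (forall x, 0 <= x -> ex_series (fun n => e n * x^n)) ->
  is_lim_seq (fun n => q n / e n) 0 ->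
  forall eps, 0 < eps -> exists X, 1 <= X /\ forall x, X <= x ->
    ex_series (fun n => Rabs (q n) * x^n) /\
    Series (fun n => Rabs (q n) * x^n) <= eps * Series (fun n => e n * x^n).
Proof.
  intros He Hex Hlim eps Heps.
  assert (Hlim' := Hlim). apply is_lim_seq_spec in Hlim'.
  destruct (Hlim' (mkposreal (eps / 2) ltac:(lra))) as [N HN]. simpl in HN.
  destruct (finite_prefix_bound q e He N) as [C [HC HCN]].
  assert (Hq : forall n, Rabs (q n) <= eps / 2 * e n + C * e (S n)).
  { intros n. pose proof (He n). pose proof (He (S n)).
    destruct (Nat.lt_ge_cases n N) as [Hn|Hn].
    - specialize (HCN n Hn). nra.
    - specialize (HN n Hn). rewrite Rminus_0_r in HN.
      unfold Rdiv in HN. rewrite Rabs_mult, Rabs_inv, (Rabs_right (e n)) in HN by lra.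
      apply Rmult_lt_compat_r with (r := e n) in HN; [|lra].
      rewrite Rmult_assoc, Rinv_l in HN by lra. nra. }
  exists (2 * C / eps + 1).
  assert (0 <= 2 * C / eps) by (apply Rdiv_le_0_compat; lra).
  split; [lra|]. intros x Hx.
  assert (Hx0 : 0 < x) by lra.
  pose proof (Hex x ltac:(lra)) as HE.
  set (b := fun n => eps / 2 * (e n * x^n) + C / x * (e (S n) * x^(S n))).
  assert (HEs : ex_series (fun n => e (S n) * x^(S n)))
    by apply (ex_series_incr_1 (fun n => e n * x^n)), HE.
  assert (Hb : ex_series b).
  { apply ex_series_Rplus.
    - apply (ex_series_Rscal (eps / 2)), HE.
    - apply (ex_series_Rscal (C / x) (fun n => e (S n) * x^(S n))), HEs. }
  assert (Hle : forall n, 0 <= Rabs (q n) * x^n <= b n).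
  { intros n. assert (Hp : 0 < x^n) by (apply pow_lt; lra). split.
    - apply Rmult_le_pos; [apply Rabs_pos|lra].
    - unfold b. specialize (Hq n).
      replace (C / x * (e (S n) * x^(S n))) with (C * e (S n) * x^n)
        by (simpl; field; lra). nra. }
  assert (Hex1 : ex_series (fun n => Rabs (q n) * x^n)).
  { apply (ex_series_le (K := R_AbsRing) (V := R_CompleteNormedModule)) with b; [|exact Hb].
    intros n. change (Rabs (Rabs (q n) * x^n) <= b n).
    rewrite Rabs_right; [apply Hle|apply Rle_ge, Hle]. }
  split; [exact Hex1|].
  apply Rle_trans with (Series b); [apply Series_le; assumption|].
  unfold b. rewrite Series_plus.
  2: apply (ex_series_Rscal (eps / 2)), HE.
  2: apply (ex_series_Rscal (C / x) (fun n => e (S n) * x^(S n))), HEs.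
  rewrite !Series_scal_l.
  set (E := Series (fun n => e n * x^n)).
  assert (HEsum : E = e O * x^O + Series (fun n => e (S n) * x^(S n)))
    by apply (Series_incr_1 (fun n => e n * x^n)), HE.
  assert (0 <= Series (fun n => e (S n) * x^(S n))).
  { apply Series_ge0; [|exact HEs]. intros n.
    apply Rmult_le_pos; [left; apply He|apply pow_le; lra]. }
  set (E' := Series (fun n => e (S n) * x^(S n))) in *.
  pose proof (He O). simpl in HEsum.
  assert (C / x <= eps / 2).
  { apply Rmult_le_reg_r with x; [lra|]. unfold Rdiv at 1.
    rewrite Rmult_assoc, Rinv_l, Rmult_1_r by lra.
    assert (eps / 2 * (2 * C / eps) = C) by (field; lra). nra. }
  assert (C / x * E' <= eps / 2 * E') by (apply Rmult_le_compat_r; assumption).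
  nra.
Qed.

Lemma ex_pseries_infinite (c : nat -> R) (x : R) :
  CV_radius c = p_infty -> ex_pseries c x.
Proof. intros H. apply CV_radius_inside. rewrite H. exact I. Qed.

Lemma ex_series_infinite (c : nat -> R) (x : R) :
  CV_radius c = p_infty -> ex_series (fun n => c n * x^n).
Proof. intros H. apply (proj1 (ex_pseries_R c x)), ex_pseries_infinite, H. Qed.

Lemma CV_radius_infinite_ratio (v : nat -> R) (l : R) :
  (forall n, v n <> 0) ->
  is_lim_seq (fun n => INR (S n) * v (S n) / v n) l -> CV_radius v = p_infty.
Proof.
  intros Hv Hl. apply CV_radius_infinite_DAlembert; [exact Hv|].
  apply is_lim_seq_ext with (fun n => Rabs (INR (S n) * v (S n) / v n * / INR (S n))).
  { intros n. f_equal. field. split; [apply Hv|apply not_0_INR; lia]. }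
  replace (Finite 0) with (Rbar_abs (l * 0)) by (simpl; rewrite Rmult_0_r, Rabs_R0; reflexivity).
  apply is_lim_seq_abs, is_lim_seq_mult'; [exact Hl|].
  apply (is_lim_seq_incr_1 (fun n => / INR n)).
  apply (is_lim_seq_inv INR p_infty); [apply is_lim_seq_INR|discriminate].
Qed.

Lemma is_lim_seq_sub_limit (u : nat -> R) (l : R) :
  is_lim_seq u l -> is_lim_seq (fun n => u n - l) 0.
Proof.
  intros H. replace (Finite 0) with (Finite (l - l)) by (f_equal; ring).
  apply (is_lim_seq_minus' u (fun _ => l)); [exact H|apply is_lim_seq_const].
Qed.

(* The probability weights proportional to [e n * x^n] have mean and standard
   deviation [x (1 + o(1))] and [o(x)]. *)
Lemma second_moment_negligible (e : nat -> R) :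
  (forall n, 0 < e n) ->
  is_lim_seq (fun n => INR (S n) * e (S n) / e n) 1 ->
  forall eps, 0 < eps -> exists X, 1 <= X /\ forall x, X <= x ->
    ex_series (fun n => (INR n / x - 1)^2 * (e n * x^n)) /\
    Series (fun n => (INR n / x - 1)^2 * (e n * x^n))
      <= eps * Series (fun n => e n * x^n).
Proof.
  intros He H1 eps Heps.
  assert (Hcv : CV_radius e = p_infty).
  { apply CV_radius_infinite_ratio with 1; [|exact H1].
    intros n. pose proof (He n). lra. }
  assert (Hcv1 : CV_radius (PS_derive e) = p_infty) by (rewrite CV_radius_derive; exact Hcv).
  assert (Hcv2 : CV_radius (PS_derive (PS_derive e)) = p_infty)
    by (rewrite CV_radius_derive; exact Hcv1).
  (* The coefficients of the first two derivatives of the series are [e n (1 + o(1))], so both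
     derivatives are asymptotic to the series itself, as for the exponential with its Poisson
     weights. *)
  assert (L1 : is_lim_seq (fun n => (PS_derive e n - e n) / e n) 0).
  { apply is_lim_seq_ext with (fun n => INR (S n) * e (S n) / e n - 1).
    - intros n. pose proof (He n). unfold PS_derive. field. lra.
    - apply is_lim_seq_sub_limit, H1. }
  assert (L2 : is_lim_seq (fun n => (PS_derive (PS_derive e) n - e n) / e n) 0).
  { apply is_lim_seq_ext with (fun n =>
      INR (S n) * e (S n) / e n * (INR (S (S n)) * e (S (S n)) / e (S n)) - 1).
    - intros n. pose proof (He n). pose proof (He (S n)). unfold PS_derive. field. lra.
    - apply is_lim_seq_sub_limit. replace 1 with (1 * 1) by ring.
      apply (is_lim_seq_mult' _ _ 1 1); [exact H1|].
      apply (is_lim_seq_incr_1 (fun n => INR (S n) * e (S n) / e n)), H1. }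
  (* Budget: [E2 - 2 E1 + E <= 3 del E <= eps/2 * E], and [E1 / x <= 2 E / x <= eps/2 * E] once
     [x >= 4 / eps]. *)
  set (del := Rmin (eps / 6) 1).
  assert (Hdel : 0 < del <= 1).
  { unfold del. split; [apply Rmin_glb_lt; lra|apply Rmin_r]. }
  assert (Hdel6 : del <= eps / 6) by apply Rmin_l.
  assert (Hexe : forall x, 0 <= x -> ex_series (fun n => e n * x^n))
    by (intros; apply ex_series_infinite, Hcv).
  destruct (series_negligible _ e He Hexe L1 del ltac:(lra)) as [X1 [HX1 S1]].
  destruct (series_negligible _ e He Hexe L2 del ltac:(lra)) as [X2 [HX2 S2]].
  exists (Rmax (Rmax X1 X2) (4 / eps)).
  split; [apply Rle_trans with (1 := HX1), Rle_trans with (2 := Rmax_l _ _), Rmax_l|].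
  intros x Hx.
  assert (Hx1 : X1 <= x)
    by (apply Rle_trans with (2 := Hx), Rle_trans with (2 := Rmax_l _ _), Rmax_l).
  assert (Hx2 : X2 <= x)
    by (apply Rle_trans with (2 := Hx), Rle_trans with (2 := Rmax_l _ _), Rmax_r).
  assert (Hx3 : 4 / eps <= x) by (apply Rle_trans with (2 := Hx), Rmax_r).
  clear Hx.
  destruct (S1 x Hx1) as [Ex1 B1]. destruct (S2 x Hx2) as [Ex2 B2].
  set (E := Series (fun n => e n * x^n)) in *.
  set (E1 := PSeries (PS_derive e) x).
  set (E2 := PSeries (PS_derive (PS_derive e)) x).
  assert (HE0 : 0 <= E).
  { apply Series_ge0; [|apply Hexe; lra]. intros n.
    apply Rmult_le_pos; [left; apply He|apply pow_le; lra]. }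
  assert (Hdiff : forall c : nat -> R, CV_radius c = p_infty ->
     ex_series (fun n => Rabs (c n - e n) * x^n) ->
     Rabs (PSeries c x - E) <= Series (fun n => Rabs (c n - e n) * x^n)).
  { intros c Hc Hexc. unfold PSeries, E.
    rewrite <- Series_minus; [|apply ex_series_infinite, Hc|apply Hexe; lra].
    assert (Heq : forall n, Rabs (c n * x^n - e n * x^n) = Rabs (c n - e n) * x^n).
    { intros n. rewrite <- Rmult_minus_distr_r, Rabs_mult, (Rabs_right (x^n)); [reflexivity|].
      apply Rle_ge, pow_le. lra. }
    rewrite <- (Series_ext _ _ Heq). apply Series_Rabs.
    apply ex_series_ext with (2 := Hexc). intros n. symmetry. apply Heq. }
  pose proof (Rle_trans _ _ _ (Hdiff _ Hcv1 Ex1) B1) as D1.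
  pose proof (Rle_trans _ _ _ (Hdiff _ Hcv2 Ex2) B2) as D2.
  fold E1 in D1. fold E2 in D2.
  apply Rabs_le_between in D1. apply Rabs_le_between in D2.
  assert (I1 : is_series (fun n => INR n * (e n * x^n)) (x * E1)).
  { apply is_series_ext with (fun n => PS_incr_1 (PS_derive e) n * x^n).
    - intros [|n].
      + change (0 * x^0 = INR 0 * (e O * x^0)). simpl. ring.
      + change (INR (S n) * e (S n) * x^(S n) = INR (S n) * (e (S n) * x^(S n))). ring.
    - apply (proj1 (is_pseries_R (PS_incr_1 (PS_derive e)) x (x * E1))).
      apply (is_pseries_incr_1 (PS_derive e) x E1).
      apply PSeries_correct, ex_pseries_infinite, Hcv1. }
  assert (I2 : is_series (fun n => INR n * (INR n - 1) * (e n * x^n)) (x * (x * E2))).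
  { apply is_series_ext with (fun n => PS_incr_1 (PS_incr_1 (PS_derive (PS_derive e))) n * x^n).
    - intros [|[|n]].
      + change (0 * x^0 = INR 0 * (INR 0 - 1) * (e O * x^0)). simpl. ring.
      + change (0 * x^1 = INR 1 * (INR 1 - 1) * (e 1%nat * x^1)). simpl. ring.
      + change (INR (S n) * (INR (S (S n)) * e (S (S n))) * x^(S (S n))
          = INR (S (S n)) * (INR (S (S n)) - 1) * (e (S (S n)) * x^(S (S n)))).
        rewrite !S_INR. ring.
    - apply (proj1 (is_pseries_R (PS_incr_1 (PS_incr_1 (PS_derive (PS_derive e)))) x
        (x * (x * E2)))).
      apply (is_pseries_incr_1 (PS_incr_1 (PS_derive (PS_derive e))) x (x * E2)).
      apply (is_pseries_incr_1 (PS_derive (PS_derive e)) x E2).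
      apply PSeries_correct, ex_pseries_infinite, Hcv2. }
  assert (I0 : is_series (fun n => e n * x^n) E) by (apply Series_correct, Hexe; lra).
  (* Expands [(n/x - 1)^2] over [n (n - 1)], [n] and [1], whose weighted sums are [x^2 E2], [x E1]
     and [E]. *)
  assert (I : is_series (fun n => (INR n / x - 1)^2 * (e n * x^n))
     (/ x^2 * (x * (x * E2)) + ((/ x^2 - 2 / x) * (x * E1) + E))).
  { apply is_series_ext with (fun n => / x^2 * (INR n * (INR n - 1) * (e n * x^n))
      + ((/ x^2 - 2 / x) * (INR n * (e n * x^n)) + e n * x^n)).
    - intros n. match goal with |- @eq _ ?l ?r => change (@eq R l r) end. field. lra.
    - apply (is_series_plus (V := R_NormedModule)).
      + apply (is_series_scal (V := R_NormedModule) (/ x^2)), I2.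
      + apply (is_series_plus (V := R_NormedModule)); [|exact I0].
        apply (is_series_scal (V := R_NormedModule) (/ x^2 - 2 / x)), I1. }
  split; [eexists; exact I|].
  rewrite (is_series_unique _ _ I).
  replace (/ x^2 * (x * (x * E2)) + ((/ x^2 - 2 / x) * (x * E1) + E))
    with (E2 - 2 * E1 + E + E1 * / x) by (field; lra).
  assert (Hix : / x <= eps / 4).
  { replace (eps / 4) with (/ (4 / eps)) by (field; lra).
    apply Rinv_le_contravar; [apply Rdiv_lt_0_compat; lra|exact Hx3]. }
  assert (0 < / x) by (apply Rinv_0_lt_compat; lra).
  assert (E1 * / x <= 2 * E * (eps / 4)).
  { apply Rle_trans with (2 * E * / x).
    - apply Rmult_le_compat_r; [lra|]. nra.
    - apply Rmult_le_compat_l; lra. }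
  nra.
Qed.

(** The case [0] stands apart because [Rpower 0 (1/3)] is [exp 0 = 1]: [ln] takes the default value
    [0] at [0]. *)
Definition cbrt_seq (n : nat) : R :=
  match n with O => 0 | S _ => Rpower (INR n) (1/3) end.

Lemma Rpower_third_cube (x : R) : 0 < x -> (Rpower x (1/3))^3 = x.
Proof.
  intros Hx. rewrite <- Rpower_pow by apply exp_pos. rewrite Rpower_mult.
  replace (1/3 * INR 3) with 1 by (simpl; field). apply Rpower_1, Hx.
Qed.

Lemma cbrt_seq_ge0 (n : nat) : 0 <= cbrt_seq n.
Proof. destruct n; simpl; [lra|left; apply exp_pos]. Qed.

Lemma cbrt_seq_cube (n : nat) : (cbrt_seq n)^3 = INR n.
Proof.
  destruct n as [|n]; [simpl; ring|].
  unfold cbrt_seq. apply Rpower_third_cube, lt_0_INR. lia.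
Qed.

(** [c^3 - X^3] factors as [c - X] times [c^2 + c X + X^2 >= X^2]. This transfers concentration of
    [n / x] around [1] to cube roots. *)
Lemma cbrt_diff_le (c X : R) : 0 <= c -> 0 < X ->
  Rabs (c - X) <= X * Rabs (c^3 / X^3 - 1).
Proof.
  intros Hc HX.
  replace (c^3 / X^3 - 1) with ((c - X) * ((c^2 + c * X + X^2) / X^3)) by (field; lra).
  rewrite Rabs_mult, (Rabs_right (_ / _)).
  2:{ apply Rle_ge, Rdiv_le_0_compat; [nra|apply pow_lt, HX]. }
  replace (X * (Rabs (c - X) * ((c^2 + c * X + X^2) / X^3)))
    with (Rabs (c - X) * ((c^2 + c * X + X^2) / X^2)) by (field; lra).
  rewrite <- (Rmult_1_r (Rabs (c - X))) at 1.
  apply Rmult_le_compat_l; [apply Rabs_pos|].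
  apply Rmult_le_reg_r with (X^2); [nra|]. unfold Rdiv.
  rewrite Rmult_assoc, Rinv_l, Rmult_1_r by nra. nra.
Qed.

Lemma cbrt_deviation_negligible (e : nat -> R) :
  (forall n, 0 < e n) ->
  is_lim_seq (fun n => INR (S n) * e (S n) / e n) 1 ->
  forall eps, 0 < eps -> exists X, 1 <= X /\ forall x, X <= x ->
    ex_series (fun n => Rabs (cbrt_seq n - Rpower x (1/3)) * (e n * x^n)) /\
    Series (fun n => Rabs (cbrt_seq n - Rpower x (1/3)) * (e n * x^n))
      <= eps * (Rpower x (1/3) * Series (fun n => e n * x^n)).
Proof.
  intros He H1 eps Heps.
  assert (Hcv : CV_radius e = p_infty).
  { apply CV_radius_infinite_ratio with 1; [|exact H1].
    intros n. pose proof (He n). lra. }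
  (* The first absolute moment is bounded through [|z| <= eps/2 + 2/eps * z^2]; a second moment of
     [eps^2/4] turns the last term into [eps/2]. *)
  destruct (second_moment_negligible e He H1 (eps^2/4) ltac:(nra)) as [X [HX HS]].
  exists X. split; [exact HX|]. intros x Hx.
  destruct (HS x Hx) as [Hex Hle]. clear HS.
  assert (HE : ex_series (fun n => e n * x^n)) by apply ex_series_infinite, Hcv.
  set (E := Series (fun n => e n * x^n)) in *.
  set (Y := Rpower x (1/3)) in *.
  assert (HY : 0 < Y) by apply exp_pos.
  assert (HY3 : Y^3 = x) by (apply Rpower_third_cube; lra).
  set (b := fun n => Y * (eps / 2) * (e n * x^n)
    + Y * (2 / eps) * ((INR n / x - 1)^2 * (e n * x^n))).
  assert (Hb : ex_series b)
    by (apply ex_series_Rplus; apply ex_series_Rscal; assumption).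
  assert (Hbound : forall n, 0 <= Rabs (cbrt_seq n - Y) * (e n * x^n) <= b n).
  { intros n.
    assert (Hw : 0 <= e n * x^n).
    { apply Rmult_le_pos; [left; apply He|apply pow_le; lra]. }
    split; [apply Rmult_le_pos; [apply Rabs_pos|exact Hw]|].
    unfold b.
    pose proof (cbrt_diff_le (cbrt_seq n) Y (cbrt_seq_ge0 n) HY) as Hc.
    rewrite cbrt_seq_cube, HY3 in Hc.
    set (z := INR n / x - 1) in *.
    assert (Hz : Rabs z <= eps / 2 + 2 / eps * z^2).
    { rewrite <- (pow2_abs z).
      assert (0 <= 2 / eps * (Rabs z - eps / 4)^2).
      { apply Rmult_le_pos; [left; apply Rdiv_lt_0_compat; lra|apply pow2_ge_0]. }
      replace (2 / eps * (Rabs z - eps / 4)^2)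
        with (2 / eps * Rabs z ^ 2 - Rabs z + eps / 8) in H by (field; lra).
      lra. }
    apply Rle_trans with (Y * (eps / 2 + 2 / eps * z^2) * (e n * x^n)).
    - apply Rmult_le_compat_r; [exact Hw|].
      apply Rle_trans with (1 := Hc). apply Rmult_le_compat_l; lra.
    - right. ring. }
  split.
  - apply (ex_series_le (K := R_AbsRing) (V := R_CompleteNormedModule)) with b; [|exact Hb].
    intros n. change (Rabs (Rabs (cbrt_seq n - Y) * (e n * x^n)) <= b n).
    rewrite Rabs_right; [apply Hbound|apply Rle_ge, Hbound].
  - apply Rle_trans with (Series b); [apply Series_le; assumption|].
    unfold b. rewrite Series_plus by (apply ex_series_Rscal; assumption).
    rewrite !Series_scal_l. fold E.
    assert (Y * (2 / eps) * Series (fun n => (INR n / x - 1)^2 * (e n * x^n))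
      <= Y * (2 / eps) * (eps^2 / 4 * E)).
    { apply Rmult_le_compat_l; [|exact Hle].
      apply Rmult_le_pos; [lra|left; apply Rdiv_lt_0_compat; lra]. }
    replace (Y * (2 / eps) * (eps^2 / 4 * E)) with (Y * (eps / 2) * E) in H by (field; lra).
    lra.
Qed.

Lemma eventually_constant_sign (v : nat -> R) :
  (forall n, v n <> 0) ->
  is_lim_seq (fun n => INR (S n) * v (S n) / v n) 1 ->
  exists sg, Rabs sg = 1 /\ exists N, forall n, (N <= n)%nat -> v n = sg * Rabs (v n).
Proof.
  intros Hv H1.
  apply is_lim_seq_spec in H1.
  destruct (H1 (mkposreal 1 ltac:(lra))) as [N HN]. simpl in HN.
  exists (sign (v N)).
  assert (Hsg : sign (v N) = 1 \/ sign (v N) = -1).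
  { destruct (Rdichotomy _ _ (Hv N)) as [Hn|Hn].
    - right. apply sign_eq_m1, Hn.
    - left. apply sign_eq_1, Hn. }
  split.
  { destruct Hsg as [-> | ->]; [apply Rabs_R1|apply Rabs_m1]. }
  exists N.
  assert (Hpos : forall n, (N <= n)%nat -> 0 < sign (v N) * v n).
  { intros n Hn. induction Hn as [|n Hn IH].
    - destruct (Rdichotomy _ _ (Hv N)) as [Hs|Hs].
      + rewrite sign_eq_m1 by exact Hs. lra.
      + rewrite sign_eq_1 by exact Hs. lra.
    - specialize (HN n Hn).
      (* Refolds the [INR (S n)] that the earlier [simpl] unfolded. *)
      change (match n with 0%nat => 1 | S _ => INR n + 1 end) with (INR (S n)) in HN.
      apply Rabs_lt_between in HN. destruct HN as [HN _].
      assert (Hq : 0 < INR (S n) * v (S n) / v n) by lra.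
      assert (HS : 0 < INR (S n)) by (apply lt_0_INR; lia).
      assert (Hr : 0 < v (S n) / v n).
      { replace (v (S n) / v n) with (INR (S n) * v (S n) / v n * / INR (S n)).
        - apply Rmult_lt_0_compat; [exact Hq|apply Rinv_0_lt_compat, HS].
        - field. split; [apply Hv|lra]. }
      replace (sign (v N) * v (S n)) with (sign (v N) * v n * (v (S n) / v n))
        by (field; apply Hv).
      apply Rmult_lt_0_compat; assumption. }
  intros n Hn. specialize (Hpos n Hn).
  destruct Hsg as [E | E]; rewrite E in *.
  - rewrite Rabs_right; lra.
  - rewrite Rabs_left; lra.
Qed.

Lemma is_lim_seq_ratio_abs (v : nat -> R) :
  is_lim_seq (fun n => INR (S n) * v (S n) / v n) 1 ->
  is_lim_seq (fun n => INR (S n) * Rabs (v (S n)) / Rabs (v n)) 1.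
Proof.
  intros H.
  apply is_lim_seq_ext with (fun n => Rabs (INR (S n) * v (S n) / v n)).
  - intros n. unfold Rdiv. rewrite !Rabs_mult, Rabs_inv, (Rabs_right (INR (S n))); [reflexivity|].
    apply Rle_ge, pos_INR.
  - replace (Finite 1) with (Rbar_abs 1) by (simpl; rewrite Rabs_R1; reflexivity).
    apply is_lim_seq_abs, H.
Qed.

(** Up to one global sign, [v] and [|v|] differ in finitely many terms only, and these make up at
    most half of the sum for large [x]. So cancellation in [PSeries v] is harmless. *)
Lemma abs_series_le_twice (v : nat -> R) :
  (forall n, v n <> 0) ->
  is_lim_seq (fun n => INR (S n) * v (S n) / v n) 1 ->
  exists X, 1 <= X /\ forall x, X <= x ->
    Series (fun n => Rabs (v n) * x^n) <= 2 * Rabs (PSeries v x).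
Proof.
  intros Hv H1.
  set (e := fun n => Rabs (v n)).
  assert (He : forall n, 0 < e n) by (intros n; apply Rabs_pos_lt, Hv).
  pose proof (is_lim_seq_ratio_abs v H1) as H1e.
  assert (Hcv : CV_radius e = p_infty).
  { apply CV_radius_infinite_ratio with 1; [|exact H1e].
    intros n. pose proof (He n). lra. }
  assert (Hcvv : CV_radius v = p_infty) by (apply CV_radius_infinite_ratio with 1; assumption).
  destruct (eventually_constant_sign v Hv H1) as [sg [Hsg [N HN]]].
  set (q := fun n => v n - sg * e n).
  assert (Hq : is_lim_seq (fun n => q n / e n) 0).
  { apply is_lim_seq_ext_loc with (fun _ => 0); [|apply is_lim_seq_const].
    exists N. intros n Hn. unfold q, e. rewrite <- HN by exact Hn. unfold Rdiv. ring. }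
  assert (Hexe : forall x, 0 <= x -> ex_series (fun n => e n * x^n))
    by (intros; apply ex_series_infinite, Hcv).
  destruct (series_negligible q e He Hexe Hq (1/2) ltac:(lra)) as [X [HX HS]].
  exists X. split; [exact HX|]. intros x Hx.
  destruct (HS x Hx) as [Hex Hle].
  change (Series (fun n => Rabs (v n) * x^n)) with (Series (fun n => e n * x^n)).
  set (E := Series (fun n => e n * x^n)) in *.
  assert (HE0 : 0 <= E).
  { apply Series_ge0; [|apply Hexe; lra]. intros n.
    apply Rmult_le_pos; [left; apply He|apply pow_le; lra]. }
  assert (Hd : Rabs (PSeries v x - sg * E) <= 1/2 * E).
  { apply Rle_trans with (2 := Hle). unfold PSeries, E.
    rewrite <- Series_scal_l, <- Series_minus;
      [|apply ex_series_infinite, Hcvv|apply ex_series_Rscal, Hexe; lra].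
    assert (Heq : forall n, Rabs (v n * x^n - sg * (e n * x^n)) = Rabs (q n) * x^n).
    { intros n. unfold q.
      replace (v n * x^n - sg * (e n * x^n)) with ((v n - sg * e n) * x^n) by ring.
      rewrite Rabs_mult, (Rabs_right (x^n)); [reflexivity|].
      apply Rle_ge, pow_le. lra. }
    rewrite <- (Series_ext _ _ Heq). apply Series_Rabs.
    apply ex_series_ext with (2 := Hex). intros n. symmetry. apply Heq. }
  assert (Rabs (sg * E) <= Rabs (PSeries v x) + 1/2 * E).
  { replace (sg * E) with (PSeries v x - (PSeries v x - sg * E)) by ring.
    unfold Rminus at 1. apply Rle_trans with (1 := Rabs_triang _ _).
    rewrite Rabs_Ropp. lra. }
  rewrite Rabs_mult, Hsg, (Rabs_right E) in H by lra. lra.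
Qed.

Lemma ex_series_INR_mult (e : nat -> R) (x : R) :
  CV_radius e = p_infty -> ex_series (fun n => INR n * (e n * x^n)).
Proof.
  intros Hcv.
  apply ex_series_ext with (fun n => PS_incr_1 (PS_derive e) n * x^n).
  - intros [|n].
    + change (0 * x^0 = INR 0 * (e O * x^0)). simpl. ring.
    + change (INR (S n) * e (S n) * x^(S n) = INR (S n) * (e (S n) * x^(S n))). ring.
  - apply ex_series_infinite. rewrite CV_radius_incr_1, CV_radius_derive. exact Hcv.
Qed.

Lemma cbrt_seq_le (n : nat) : cbrt_seq n <= 1 + INR n.
Proof.
  pose proof (cbrt_seq_ge0 n). pose proof (cbrt_seq_cube n). pose proof (pos_INR n).
  destruct (Rle_lt_dec (cbrt_seq n) 1); [lra|]. nra.
Qed.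

(** With [Y = x^(1/3)], the coefficients of the difference split as [(k n - kappa) n^(1/3) v n],
    negligible because [k] converges, and [kappa (n^(1/3) - Y) v n], negligible because the weights
    concentrate at [n ~ x]. *)
Lemma pseries_cbrt_ratio (u v k : nat -> R) (kappa : R) :
  (forall n, v n <> 0) ->
  is_lim_seq (fun n => INR (S n) * v (S n) / v n) 1 ->
  CV_radius u = p_infty ->
  is_lim_seq k kappa ->
  (forall n, (0 < n)%nat -> u n = k n * cbrt_seq n * v n) ->
  forall eps, 0 < eps -> exists X, 1 <= X /\ forall x, X <= x ->
    Rabs (PSeries u x - kappa * (Rpower x (1/3) * PSeries v x))
      <= eps * (Rpower x (1/3) * Rabs (PSeries v x)).
Proof.
  intros Hv H1 Hcvu Hk Huv eps Heps.
  set (e := fun n => Rabs (v n)).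
  assert (He : forall n, 0 < e n) by (intros n; apply Rabs_pos_lt, Hv).
  pose proof (is_lim_seq_ratio_abs v H1) as H1e.
  assert (Hcv : CV_radius e = p_infty).
  { apply CV_radius_infinite_ratio with 1; [|exact H1e].
    intros n. pose proof (He n). lra. }
  assert (Hcvv : CV_radius v = p_infty) by (apply CV_radius_infinite_ratio with 1; assumption).
  (* The [1 +] keeps [e'] positive at [n = 0], where [cbrt_seq] vanishes, as [series_negligible]
     demands. *)
  set (e' := fun n => (1 + cbrt_seq n) * e n).
  assert (He' : forall n, 0 < e' n).
  { intros n. unfold e'. pose proof (cbrt_seq_ge0 n).
    apply Rmult_lt_0_compat; [lra|apply He]. }
  assert (Hexe' : forall x, 0 <= x -> ex_series (fun n => e' n * x^n)).
  { intros x Hx.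
    apply (ex_series_le (K := R_AbsRing) (V := R_CompleteNormedModule))
      with (fun n => 2 * (e n * x^n) + INR n * (e n * x^n)).
    - intros n. change (Rabs (e' n * x^n) <= 2 * (e n * x^n) + INR n * (e n * x^n)).
      assert (Hw : 0 <= e n * x^n).
      { apply Rmult_le_pos; [left; apply He|apply pow_le; lra]. }
      unfold e'. pose proof (cbrt_seq_ge0 n). pose proof (cbrt_seq_le n).
      replace ((1 + cbrt_seq n) * e n * x^n) with ((1 + cbrt_seq n) * (e n * x^n)) by ring.
      rewrite Rabs_right by nra. nra.
    - apply ex_series_Rplus.
      + apply ex_series_Rscal, ex_series_infinite, Hcv.
      + apply ex_series_INR_mult, Hcv. }
  set (q := fun n => u n - kappa * cbrt_seq n * v n).
  assert (Hq : is_lim_seq (fun n => q n / e' n) 0).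
  { apply is_lim_seq_abs_0.
    apply is_lim_seq_le_le_loc with (fun _ => 0) (fun n => Rabs (k n - kappa)).
    - exists 1%nat. intros n Hn. split; [apply Rabs_pos|].
      unfold q. rewrite Huv by lia.
      replace (k n * cbrt_seq n * v n - kappa * cbrt_seq n * v n)
        with ((k n - kappa) * cbrt_seq n * v n) by ring.
      unfold Rdiv. rewrite !Rabs_mult, Rabs_inv.
      fold (e n).
      pose proof (cbrt_seq_ge0 n). pose proof (He n). pose proof (He' n).
      rewrite (Rabs_right (cbrt_seq n)), (Rabs_right (e' n)) by lra.
      apply Rmult_le_reg_r with (e' n); [lra|].
      rewrite Rmult_assoc, Rinv_l, Rmult_1_r by lra.
      unfold e'. pose proof (Rabs_pos (k n - kappa)).
      assert (0 <= Rabs (k n - kappa) * e n) by (apply Rmult_le_pos; lra). nra.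
    - apply is_lim_seq_const.
    - apply (is_lim_seq_abs_0 (fun n => k n - kappa)), is_lim_seq_sub_limit, Hk. }
  pose proof (Rabs_pos kappa) as Hk0.
  (* The error will be [del * (3 + |kappa|) * Y * E]: the [3] comes from [1 + Y + del * Y <= 3 Y],
     and the [2] from [E <= 2 |PSeries v x|]. *)
  set (del := Rmin 1 (eps / (2 * (3 + Rabs kappa)))).
  assert (Hdel : 0 < del <= 1).
  { unfold del. split; [|apply Rmin_l].
    apply Rmin_glb_lt; [lra|apply Rdiv_lt_0_compat; lra]. }
  assert (Hdele : del * (2 * (3 + Rabs kappa)) <= eps).
  { apply Rle_trans with (eps / (2 * (3 + Rabs kappa)) * (2 * (3 + Rabs kappa))).
    - apply Rmult_le_compat_r; [lra|apply Rmin_r].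
    - right. field. lra. }
  destruct (series_negligible q e' He' Hexe' Hq del ltac:(lra)) as [X1 [HX1 S1]].
  destruct (cbrt_deviation_negligible e He H1e del ltac:(lra)) as [X2 [HX2 S2]].
  destruct (abs_series_le_twice v Hv H1) as [X3 [HX3 S3]].
  exists (Rmax X1 (Rmax X2 X3)).
  split; [apply Rle_trans with (1 := HX1), Rmax_l|].
  intros x Hx.
  assert (Hx1 : X1 <= x) by (apply Rle_trans with (2 := Hx), Rmax_l).
  assert (Hx2 : X2 <= x)
    by (apply Rle_trans with (2 := Hx), Rle_trans with (2 := Rmax_r _ _), Rmax_l).
  assert (Hx3 : X3 <= x)
    by (apply Rle_trans with (2 := Hx), Rle_trans with (2 := Rmax_r _ _), Rmax_r).
  clear Hx.
  destruct (S1 x Hx1) as [Ex1 B1]. destruct (S2 x Hx2) as [Ex2 B2].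
  pose proof (S3 x Hx3) as B3. clear S1 S2 S3.
  change (Series (fun n => Rabs (v n) * x^n)) with (Series (fun n => e n * x^n)) in B3.
  assert (HexE : ex_series (fun n => e n * x^n)) by apply ex_series_infinite, Hcv.
  set (E := Series (fun n => e n * x^n)) in *.
  set (Y := Rpower x (1/3)) in *.
  assert (HY : 1 <= Y).
  { apply Rle_trans with (Rpower x 0); [rewrite Rpower_O; lra|].
    apply Rle_Rpower; lra. }
  assert (HE0 : 0 <= E).
  { apply Series_ge0; [|exact HexE]. intros n.
    apply Rmult_le_pos; [left; apply He|apply pow_le; lra]. }
  assert (BE' : Series (fun n => e' n * x^n) <= 3 * (Y * E)).
  { apply Rle_trans with (Series (fun n => (1 + Y) * (e n * x^n)
      + Rabs (cbrt_seq n - Y) * (e n * x^n))).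
    - apply Series_le.
      + intros n.
        assert (Hw : 0 <= e n * x^n).
        { apply Rmult_le_pos; [left; apply He|apply pow_le; lra]. }
        unfold e'. pose proof (cbrt_seq_ge0 n). pose proof (Rle_abs (cbrt_seq n - Y)).
        split; nra.
      + apply ex_series_Rplus; [apply ex_series_Rscal|]; assumption.
    - rewrite Series_plus by (try apply ex_series_Rscal; assumption).
      rewrite Series_scal_l. fold E.
      assert (E <= Y * E) by nra.
      assert (del * (Y * E) <= Y * E) by nra. lra. }
  assert (Hmain : Rabs (PSeries u x - kappa * (Y * PSeries v x))
    <= del * (3 * (Y * E)) + Rabs kappa * (del * (Y * E))).
  { unfold PSeries. rewrite <- !Series_scal_l.
    rewrite <- Series_minus;
      [|apply ex_series_infinite, Hcvu
       |apply ex_series_Rscal, ex_series_Rscal, ex_series_infinite, Hcvv].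
    set (b := fun n => Rabs (q n) * x^n
      + Rabs kappa * (Rabs (cbrt_seq n - Y) * (e n * x^n))).
    assert (Hb : ex_series b).
    { apply ex_series_Rplus; [exact Ex1|]. apply ex_series_Rscal, Ex2. }
    assert (Hterm : forall n,
      Rabs (u n * x^n - kappa * (Y * (v n * x^n))) <= b n).
    { intros n. assert (Hp : 0 <= x^n) by (apply pow_le; lra).
      replace (u n * x^n - kappa * (Y * (v n * x^n)))
        with (q n * x^n + kappa * ((cbrt_seq n - Y) * (v n * x^n)))
        by (unfold q; ring).
      apply Rle_trans with (1 := Rabs_triang _ _).
      rewrite !Rabs_mult, (Rabs_right (x^n)) by lra. unfold b. fold (e n). lra. }
    assert (Hexabs : ex_series (fun n => Rabs (u n * x^n - kappa * (Y * (v n * x^n))))).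
    { apply (ex_series_le (K := R_AbsRing) (V := R_CompleteNormedModule)) with b; [|exact Hb].
      intros n. change (Rabs (Rabs (u n * x^n - kappa * (Y * (v n * x^n)))) <= b n).
      rewrite Rabs_Rabsolu. apply Hterm. }
    apply Rle_trans with (1 := Series_Rabs _ Hexabs).
    apply Rle_trans with (Series b).
    { apply Series_le; [|exact Hb]. intros n. split; [apply Rabs_pos|apply Hterm]. }
    unfold b. rewrite Series_plus; [|exact Ex1|apply ex_series_Rscal, Ex2].
    rewrite Series_scal_l. apply Rplus_le_compat.
    - apply Rle_trans with (1 := B1). apply Rmult_le_compat_l; lra.
    - apply Rmult_le_compat_l; [exact Hk0|exact B2]. }
  apply Rle_trans with (1 := Hmain).
  set (V := Rabs (PSeries v x)) in *.
  assert (0 <= V) by apply Rabs_pos.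
  assert (HYE : Y * E <= 2 * (Y * V)) by nra.
  assert (0 <= Y * V) by nra.
  replace (del * (3 * (Y * E)) + Rabs kappa * (del * (Y * E)))
    with (del * (3 + Rabs kappa) * (Y * E)) by ring.
  apply Rle_trans with (del * (3 + Rabs kappa) * (2 * (Y * V))).
  - apply Rmult_le_compat_l; [apply Rmult_le_pos; lra|exact HYE].
  - replace (del * (3 + Rabs kappa) * (2 * (Y * V)))
      with (del * (2 * (3 + Rabs kappa)) * (Y * V)) by ring.
    apply Rmult_le_compat_r; assumption.
Qed.

(** * The Gauss product *)

Lemma poch_neq0 (x : R) (n : nat) : (forall m, x + INR m <> 0) -> poch x n <> 0.
Proof.
  intros Hx. induction n as [|n IH]; simpl; [lra|].
  apply Rmult_integral_contrapositive_currified; [exact IH|apply Hx].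
Qed.

Lemma poch_shift (x : R) (n : nat) : x * poch (x + 1) n = poch x (S n).
Proof.
  induction n as [|n IH]; [simpl; ring|].
  change (x * (poch (x + 1) n * (x + 1 + INR n)) = poch x (S n) * (x + INR (S n))).
  rewrite <- IH, S_INR. ring.
Qed.

Definition gauss (x : R) (n : nat) : R :=
  INR (Factorial.fact n) * Rpower (INR n) x / poch x (S n).

Lemma gauss_neq0 (x : R) (n : nat) : (forall m, x + INR m <> 0) -> gauss x n <> 0.
Proof.
  intros Hx. unfold gauss, Rdiv.
  apply Rmult_integral_contrapositive_currified.
  - apply Rmult_integral_contrapositive_currified; [apply INR_fact_neq_0|].
    apply Rgt_not_eq, exp_pos.
  - apply Rinv_neq_0_compat, poch_neq0, Hx.
Qed.

Lemma ln_ratio_bounds (y z : R) : 0 < y -> 0 < z ->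
  (y - z) / y <= ln y - ln z <= (y - z) / z.
Proof.
  intros Hy Hz.
  assert (Hle : forall r, 0 < r -> ln r <= r - 1).
  { intros r Hr. pose proof (exp_ineq1_le (ln r)). rewrite exp_ln in H by exact Hr. lra. }
  split.
  - pose proof (Hle (z / y) (Rdiv_lt_0_compat _ _ Hz Hy)).
    rewrite ln_div in H by assumption.
    replace ((y - z) / y) with (1 - z / y) by (field; lra). lra.
  - pose proof (Hle (y / z) (Rdiv_lt_0_compat _ _ Hy Hz)).
    rewrite ln_div in H by assumption.
    replace ((y - z) / z) with (y / z - 1) by (field; lra). lra.
Qed.

(** The logarithm of [gauss x (S n) / gauss x n], grouped into two differences that are both
    [x / (n + 1)] to leading order. *)
Definition gauss_increment (x : R) (n : nat) : R :=
  x * (ln (INR (S n)) - ln (INR n)) - (ln (x + INR (S n)) - ln (INR (S n))).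

Lemma gauss_increment_spec (x : R) (n : nat) :
  (forall m, x + INR m <> 0) -> 0 < INR n -> 0 < x + INR (S n) ->
  gauss x (S n) = gauss x n * exp (gauss_increment x n).
Proof.
  intros Hx Hn HSn.
  assert (Hs : 0 < INR (S n)) by (rewrite S_INR; lra).
  unfold gauss, gauss_increment, Rpower.
  replace (x * ln (INR (S n)))
    with (x * ln (INR n) + x * (ln (INR (S n)) - ln (INR n))) by ring.
  set (A := x * (ln (INR (S n)) - ln (INR n))).
  unfold Rminus at 1. rewrite (exp_plus A), (exp_plus (x * ln (INR n))).
  rewrite Ropp_minus_distr, <- ln_div, exp_ln by (try apply Rdiv_lt_0_compat; lra).
  change (poch x (S (S n))) with (poch x (S n) * (x + INR (S n))).
  rewrite fact_simpl, mult_INR. field.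
  repeat split; try lra; apply poch_neq0, Hx.
Qed.

(** Each logarithm difference is within [O(1 / (n (n + 1)))] of [x / (n + 1)], so the leading parts
    cancel. The condition [2 |x| <= n] gives [x + n + 1 >= n / 2], whence the factor [2] before
    [x^2]. *)
Lemma gauss_increment_bound (x : R) (n : nat) :
  1 <= INR n -> 2 * Rabs x <= INR n ->
  Rabs (gauss_increment x n) <= (Rabs x + 2 * x^2) / (INR n * INR (S n)).
Proof.
  intros Hn Hxn. rewrite S_INR. set (N := INR n) in *.
  assert (Hx : - (N / 2) <= x <= N / 2).
  { apply Rabs_le_between. lra. }
  unfold gauss_increment. rewrite S_INR. fold N.
  assert (B1 : Rabs (x * (ln (N + 1) - ln N) - x / (N + 1)) <= Rabs x / (N * (N + 1))).
  { replace (x * (ln (N + 1) - ln N) - x / (N + 1))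
      with (x * ((ln (N + 1) - ln N) - / (N + 1))) by (field; lra).
    rewrite Rabs_mult. unfold Rdiv. apply Rmult_le_compat_l; [apply Rabs_pos|].
    destruct (ln_ratio_bounds (N + 1) N ltac:(lra) ltac:(lra)) as [L1 L2].
    replace ((N + 1 - N) / (N + 1)) with (/ (N + 1)) in L1 by (field; lra).
    replace ((N + 1 - N) / N) with (/ (N + 1) + / (N * (N + 1))) in L2 by (field; lra).
    apply Rabs_le. split; [|lra].
    assert (0 < / (N * (N + 1))) by (apply Rinv_0_lt_compat; nra). lra. }
  assert (B2 : Rabs ((ln (x + (N + 1)) - ln (N + 1)) - x / (N + 1))
      <= 2 * x^2 / (N * (N + 1))).
  { destruct (ln_ratio_bounds (x + (N + 1)) (N + 1) ltac:(lra) ltac:(lra)) as [L1 L2].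
    replace ((x + (N + 1) - (N + 1)) / (N + 1)) with (x / (N + 1)) in L2 by (field; lra).
    replace ((x + (N + 1) - (N + 1)) / (x + (N + 1)))
      with (x / (N + 1) - x^2 * (/ (N + 1) * / (x + (N + 1)))) in L1 by (field; lra).
    assert (H1 : x^2 * (/ (N + 1) * / (x + (N + 1))) <= 2 * x^2 / (N * (N + 1))).
    { replace (2 * x^2 / (N * (N + 1))) with (x^2 * (/ (N + 1) * / (N / 2))) by (field; lra).
      apply Rmult_le_compat_l; [apply pow2_ge_0|].
      apply Rmult_le_compat_l; [left; apply Rinv_0_lt_compat; lra|].
      apply Rinv_le_contravar; lra. }
    assert (H2 : 0 <= 2 * x^2 / (N * (N + 1))).
    { apply Rdiv_le_0_compat; [pose proof (pow2_ge_0 x); lra|nra]. }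
    apply Rabs_le. lra. }
  set (p := x * (ln (N + 1) - ln N)) in *.
  set (r := ln (x + (N + 1)) - ln (N + 1)) in *.
  replace (p - r) with ((p - x / (N + 1)) - (r - x / (N + 1))) by ring.
  unfold Rminus at 1. apply Rle_trans with (1 := Rabs_triang _ _).
  rewrite Rabs_Ropp.
  replace ((Rabs x + 2 * x^2) / (N * (N + 1)))
    with (Rabs x / (N * (N + 1)) + 2 * x^2 / (N * (N + 1))) by (field; lra).
  lra.
Qed.

(* [L n - C / (N + n)] increases and [L n + C / (N + n)] decreases. *)
Lemma ex_finite_lim_seq_telescoping (L : nat -> R) (C : R) (N : nat) :
  (0 < N)%nat ->
  (forall n, Rabs (L (S n) - L n) <= C / (INR (N + n) * INR (S (N + n)))) ->
  ex_finite_lim_seq L.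
Proof.
  intros HN HL.
  assert (Hpos : forall n, 0 < INR (N + n)) by (intros n; apply lt_0_INR; lia).
  assert (HC : 0 <= C).
  { specialize (HL O). pose proof (Rle_trans _ _ _ (Rabs_pos _) HL) as H.
    pose proof (Hpos O) as h0. pose proof (Hpos 1%nat) as h1.
    replace (N + 1)%nat with (S (N + 0)) in h1 by lia.
    apply Rmult_le_reg_r with (/ (INR (N + 0) * INR (S (N + 0)))).
    - apply Rinv_0_lt_compat, Rmult_lt_0_compat; assumption.
    - rewrite Rmult_0_l. exact H. }
  assert (Hstep : forall n, C / (INR (N + n) * INR (S (N + n)))
     = C / INR (N + n) - C / INR (N + S n)).
  { intros n. replace (N + S n)%nat with (S (N + n)) by lia.
    pose proof (Hpos n). rewrite S_INR. field. lra. }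
  assert (Hinc : forall n, L n - C / INR (N + n) <= L (S n) - C / INR (N + S n)).
  { intros n. specialize (HL n). rewrite Hstep in HL.
    apply Rabs_le_between in HL. lra. }
  assert (Hdec : forall n, L (S n) + C / INR (N + S n) <= L n + C / INR (N + n)).
  { intros n. specialize (HL n). rewrite Hstep in HL.
    apply Rabs_le_between in HL. lra. }
  assert (Hub : forall n, L n + C / INR (N + n) <= L O + C / INR (N + 0)).
  { induction n as [|n IH]; [lra|]. specialize (Hdec n). lra. }
  assert (Hq : forall n, 0 <= C / INR (N + n))
    by (intros n; apply Rdiv_le_0_compat; [exact HC|apply Hpos]).
  destruct (ex_finite_lim_seq_incr (fun n => L n - C / INR (N + n)) (L O + C / INR (N + 0)))
    as [l Hl].
  - exact Hinc.
  - intros n. specialize (Hub n). specialize (Hq n). lra.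
  - exists (l + 0).
    apply is_lim_seq_ext with (fun n => (L n - C / INR (N + n)) + C / INR (N + n)).
    { intros n. ring. }
    apply is_lim_seq_plus'; [exact Hl|].
    replace (Finite 0) with (Rbar_mult C 0) by (simpl; f_equal; ring).
    apply (is_lim_seq_scal_l (fun n => / INR (N + n)) C 0).
    apply (is_lim_seq_ext (fun n => / INR (n + N))).
    { intros n. rewrite Nat.add_comm. reflexivity. }
    apply (is_lim_seq_incr_n (fun n => / INR n) N).
    apply (is_lim_seq_inv INR p_infty); [apply is_lim_seq_INR|discriminate].
Qed.

(** [Gamma] applies [real] to the total function [Lim_seq], so convergence to a finite limit must be
    shown before its value means anything. Beyond [N] the new factors [x + n] are positive, and
    [gauss x (n + N) = gauss x N * exp (L n)] with [L] convergent; the exponential also makes the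
    limit nonzero, whatever sign the first factors give. *)
Lemma gauss_converges (x : R) :
  (forall m, x + INR m <> 0) -> is_lim_seq (gauss x) (Gamma x) /\ Gamma x <> 0.
Proof.
  intros Hx.
  set (N := S (Z.to_nat (up (2 * Rabs x)))).
  assert (HN : 2 * Rabs x + 1 <= INR N).
  { unfold N. rewrite S_INR, INR_IZR_INZ, Z2Nat.id.
    - destruct (archimed (2 * Rabs x)). lra.
    - apply le_IZR. destruct (archimed (2 * Rabs x)). pose proof (Rabs_pos x). lra. }
  assert (HNn : forall n, 2 * Rabs x + 1 <= INR (N + n)).
  { intros n. rewrite plus_INR. pose proof (pos_INR n). lra. }
  assert (Hp : forall n, 1 <= INR (N + n) /\ 2 * Rabs x <= INR (N + n)
     /\ 0 < x + INR (S (N + n))).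
  { intros n. specialize (HNn n). pose proof (Rabs_pos x). rewrite S_INR.
    pose proof (Rle_abs (- x)). rewrite Rabs_Ropp in H0. lra. }
  set (L := fix L n := match n with
    O => 0 | S n' => L n' + gauss_increment x (N + n') end).
  assert (HL : forall n, gauss x (n + N) = gauss x N * exp (L n)).
  { induction n as [|n IH].
    - change (L O) with 0. rewrite exp_0. simpl. ring.
    - change (L (S n)) with (L n + gauss_increment x (N + n)).
      rewrite exp_plus, <- Rmult_assoc, <- IH.
      replace (n + N)%nat with (N + n)%nat by lia.
      replace (S n + N)%nat with (S (N + n)) by lia.
      destruct (Hp n) as [p1 [p2 p3]].
      apply gauss_increment_spec; [exact Hx|lra|exact p3]. }
  destruct (ex_finite_lim_seq_telescoping L (Rabs x + 2 * x^2) N) as [l Hl].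
  - unfold N. lia.
  - intros n. change (L (S n)) with (L n + gauss_increment x (N + n)).
    replace (L n + gauss_increment x (N + n) - L n) with (gauss_increment x (N + n)) by ring.
    destruct (Hp n) as [p1 [p2 p3]]. apply gauss_increment_bound; assumption.
  - assert (Hlim : is_lim_seq (gauss x) (gauss x N * exp l)).
    { apply (is_lim_seq_incr_n (gauss x) N).
      apply is_lim_seq_ext with (fun n => gauss x N * exp (L n)).
      { intros n. symmetry. apply HL. }
      apply (is_lim_seq_scal_l (fun n => exp (L n)) (gauss x N) (exp l)).
      apply (is_lim_seq_continuous exp L l); [|exact Hl].
      apply derivable_continuous_pt, derivable_pt_exp. }
    assert (HG : Gamma x = gauss x N * exp l).
    { unfold Gamma. fold (gauss x).
      rewrite (is_lim_seq_unique _ _ Hlim). reflexivity. }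
    rewrite HG. split; [exact Hlim|].
    apply Rmult_integral_contrapositive_currified; [apply gauss_neq0, Hx|].
    apply Rgt_not_eq, exp_pos.
Qed.

Lemma is_lim_seq_shift_ratio (a b : R) :
  is_lim_seq (fun n => (a + INR n) / (b + INR n)) 1.
Proof.
  assert (Hinf : is_lim_seq (fun n => b + INR n) p_infty).
  { apply (is_lim_seq_plus (fun _ => b) INR b p_infty p_infty);
      [apply is_lim_seq_const|apply is_lim_seq_INR|reflexivity]. }
  apply is_lim_seq_ext_loc with (fun n => 1 + (a - b) * / (b + INR n)).
  - apply is_lim_seq_spec in Hinf. destruct (Hinf 0) as [N HN].
    exists N. intros n Hn. specialize (HN n Hn). field. lra.
  - replace (Finite 1) with (Finite (1 + (a - b) * 0)) by (f_equal; ring).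
    apply is_lim_seq_plus'; [apply is_lim_seq_const|].
    apply is_lim_seq_mult'; [apply is_lim_seq_const|].
    apply (is_lim_seq_inv _ p_infty); [exact Hinf|discriminate].
Qed.

(** At finite level [gauss (x + 1) n = x * gauss x n * n / (x + 1 + n)], and the last quotient tends
    to [1]. *)
Lemma Gamma_succ (x : R) : (forall m, x + INR m <> 0) -> Gamma (x + 1) = x * Gamma x.
Proof.
  intros Hx.
  assert (Hx1 : forall m, x + 1 + INR m <> 0).
  { intros m. replace (x + 1 + INR m) with (x + INR (S m)) by (rewrite S_INR; ring). apply Hx. }
  destruct (gauss_converges x Hx) as [H0 _].
  destruct (gauss_converges (x + 1) Hx1) as [H1 _].
  assert (H2 : is_lim_seq (gauss (x + 1)) (x * Gamma x * 1)).
  { apply is_lim_seq_ext_loc with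
      (fun n => x * gauss x n * ((0 + INR n) / (x + 1 + INR n))).
    - exists 1%nat. intros n Hn. unfold gauss.
      assert (Hn0 : 0 < INR n) by (apply lt_0_INR; lia).
      rewrite Rpower_plus, Rpower_1 by exact Hn0.
      assert (Hx0 : x <> 0).
      { intros E. apply (Hx O). rewrite E. simpl. ring. }
      replace (poch (x + 1) (S n)) with (poch x (S n) * (x + 1 + INR n) / x).
      + field. repeat split; auto. apply poch_neq0, Hx.
      + apply Rmult_eq_reg_l with x; [|exact Hx0]. rewrite poch_shift.
        change (poch x (S (S n))) with (poch x (S n) * (x + INR (S n))).
        rewrite S_INR. field. exact Hx0.
    - apply is_lim_seq_mult'; [|apply is_lim_seq_shift_ratio].
      apply is_lim_seq_mult'; [apply is_lim_seq_const|exact H0]. }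
  pose proof (is_lim_seq_unique _ _ H1) as U1.
  pose proof (is_lim_seq_unique _ _ H2) as U2.
  rewrite U1 in U2. injection U2. intros E. rewrite E. ring.
Qed.

(** * Kummer's equation *)

Definition kummer_coef (a b : R) (n : nat) : R :=
  poch a n / poch b n / INR (Factorial.fact n).

Lemma KummerM_PSeries (a b z : R) : KummerM a b z = PSeries (kummer_coef a b) z.
Proof.
  unfold KummerM, PSeries, kummer_coef. apply Series_ext. intros n. unfold Rdiv. ring.
Qed.

Lemma kummer_coef_succ (a b : R) (n : nat) : (forall m, b + INR m <> 0) ->
  (b + INR n) * INR (S n) * kummer_coef a b (S n) = (a + INR n) * kummer_coef a b n.
Proof.
  intros Hb. unfold kummer_coef. rewrite fact_simpl, mult_INR.
  change (poch a (S n)) with (poch a n * (a + INR n)).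
  change (poch b (S n)) with (poch b n * (b + INR n)).
  field. pose proof (poch_neq0 b n Hb). pose proof (Hb n). pose proof (INR_fact_neq_0 n).
  assert (INR (S n) <> 0) by (apply not_0_INR; lia).
  repeat split; assumption.
Qed.

Lemma kummer_coef_neq0 (a b : R) (n : nat) :
  (forall m, a + INR m <> 0) -> (forall m, b + INR m <> 0) -> kummer_coef a b n <> 0.
Proof.
  intros Ha Hb. unfold kummer_coef, Rdiv.
  repeat apply Rmult_integral_contrapositive_currified.
  - apply poch_neq0, Ha.
  - apply Rinv_neq_0_compat, poch_neq0, Hb.
  - apply Rinv_neq_0_compat, INR_fact_neq_0.
Qed.

Lemma kummer_coef_ratio (a b : R) :
  (forall m, a + INR m <> 0) -> (forall m, b + INR m <> 0) ->
  is_lim_seq (fun n => INR (S n) * kummer_coef a b (S n) / kummer_coef a b n) 1.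
Proof.
  intros Ha Hb. apply is_lim_seq_ext with (fun n => (a + INR n) / (b + INR n)).
  - intros n. pose proof (kummer_coef_succ a b n Hb) as E.
    pose proof (kummer_coef_neq0 a b n Ha Hb) as H0.
    apply Rmult_eq_reg_r with ((b + INR n) * kummer_coef a b n).
    + transitivity ((a + INR n) * kummer_coef a b n); [field; apply Hb|].
      rewrite <- E. field. exact H0.
    + apply Rmult_integral_contrapositive_currified; [apply Hb|exact H0].
  - apply is_lim_seq_shift_ratio.
Qed.

(** Kummer's equation [z w'' + b w' = z w' + a w]. Its coefficient of [z^n] is the recurrence
    [(b + n) (n + 1) c (n+1) = (a + n) c n]; the case [n = 0] is separate because the multiples of
    [z] do not contribute there. *)
Lemma kummer_equation (a b z : R) :
  (forall m, a + INR m <> 0) -> (forall m, b + INR m <> 0) ->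
  z * PSeries (PS_derive (PS_derive (kummer_coef a b))) z
    + b * PSeries (PS_derive (kummer_coef a b)) z
  = z * PSeries (PS_derive (kummer_coef a b)) z + a * PSeries (kummer_coef a b) z.
Proof.
  intros Ha Hb. set (c := kummer_coef a b).
  assert (Hcv : CV_radius c = p_infty).
  { apply CV_radius_infinite_ratio with 1.
    - intros n. apply kummer_coef_neq0; assumption.
    - apply kummer_coef_ratio; assumption. }
  assert (Hcv1 : CV_radius (PS_derive c) = p_infty) by (rewrite CV_radius_derive; exact Hcv).
  assert (Hcv2 : CV_radius (PS_derive (PS_derive c)) = p_infty)
    by (rewrite CV_radius_derive; exact Hcv1).
  rewrite <- !PSeries_incr_1, <- !PSeries_scal.
  assert (Hscal : forall (r : R) (f : nat -> R), CV_radius f = p_infty ->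
     ex_pseries (PS_scal r f) z).
  { intros r f Hf. apply (ex_pseries_scal r f z); [apply Rmult_comm|].
    apply ex_pseries_infinite, Hf. }
  rewrite <- !PSeries_plus;
    try (apply ex_pseries_infinite; rewrite CV_radius_incr_1; assumption);
    try (apply Hscal; assumption).
  apply PSeries_ext. intros [|n].
  - change (0 + b * (INR 1 * c 1%nat) = 0 + a * c O).
    pose proof (kummer_coef_succ a b 0 Hb) as E. fold c in E. simpl in E. simpl. lra.
  - change (INR (S n) * (INR (S (S n)) * c (S (S n))) + b * (INR (S (S n)) * c (S (S n)))
      = INR (S n) * c (S n) + a * c (S n)).
    pose proof (kummer_coef_succ a b (S n) Hb) as E. fold c in E. lra.
Qed.

Lemma is_derive_kummer_pseries (c : nat -> R) (t : R) : CV_radius c = p_infty ->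
  is_derive (fun t => PSeries c (- t^3 / 9)) t
    (- (t^2 / 3) * PSeries (PS_derive c) (- t^3 / 9)).
Proof.
  intros Hc. evar_last.
  - apply (is_derive_comp (PSeries c) (fun t => - t^3 / 9)).
    + apply is_derive_PSeries. rewrite Hc. exact I.
    + instantiate (1 := - (t^2 / 3)). auto_derive; [exact I|]. field.
  - cbv [scal]; simpl. cbv [mult]; simpl. ring.
Qed.

Lemma CV_radius_kummer (a b : R) :
  (forall m, a + INR m <> 0) -> (forall m, b + INR m <> 0) ->
  CV_radius (kummer_coef a b) = p_infty.
Proof.
  intros H1 H2. apply CV_radius_infinite_ratio with 1.
  - intros n. apply kummer_coef_neq0; assumption.
  - apply kummer_coef_ratio; assumption.
Qed.

Lemma two_thirds_neq0 (m : nat) : 2/3 + INR m <> 0.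
Proof. pose proof (pos_INR m). lra. Qed.

Lemma four_thirds_neq0 (m : nat) : 4/3 + INR m <> 0.
Proof. pose proof (pos_INR m). lra. Qed.

Lemma Series_ge_term (w : nat -> R) (n : nat) :
  (forall m, 0 <= w m) -> ex_series w -> w n <= Series w.
Proof.
  revert w. induction n as [|n IH]; intros w Hw Hex;
    rewrite (Series_incr_1 w Hex);
    assert (Hex' := proj1 (ex_series_incr_1 w) Hex).
  - pose proof (Series_ge0 (fun m => w (S m)) (fun m => Hw (S m)) Hex'). lra.
  - pose proof (IH (fun m => w (S m)) (fun m => Hw (S m)) Hex'). specialize (Hw O). simpl in *. lra.
Qed.

Lemma Rpower_weight_lower (mu s : R) (N : nat) : Rabs mu <= INR N -> 1 <= s ->
  / (2 * s^2)^N <= Rpower (1 + s^2) mu.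
Proof.
  intros HN Hs.
  apply Rle_trans with (/ (1 + s^2)^N).
  - apply Rinv_le_contravar; [apply pow_lt; nra|]. apply pow_incr. nra.
  - rewrite <- Rpower_pow by nra. rewrite <- Rpower_Ropp.
    apply Rle_Rpower; [nra|]. pose proof (Rle_abs (- mu)). rewrite Rabs_Ropp in H. lra.
Qed.

(** * Two solutions in the variable [t] and their ratio at minus infinity *)

Section KummerSolutions.

Variable a : R.
Hypothesis Ha : forall m, a + INR m <> 0.
Hypothesis Ha3 : forall m, a + 1/3 + INR m <> 0.

Let u := kummer_coef a (2/3).
Let v := kummer_coef (a + 1/3) (4/3).

Lemma first_kummer_solution : exists S1 : R -> R,
  (forall t, is_derive (fun t => PSeries u (- t^3 / 9)) t (S1 t)) /\
  (forall t, is_derive S1 t (- (t^2 / 3) * S1 t - a * t * PSeries u (- t^3 / 9))).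
Proof.
  pose proof (CV_radius_kummer a (2/3) Ha two_thirds_neq0) as Hcv. fold u in Hcv.
  assert (Hcv1 : CV_radius (PS_derive u) = p_infty) by (rewrite CV_radius_derive; exact Hcv).
  exists (fun t => - (t^2 / 3) * PSeries (PS_derive u) (- t^3 / 9)).
  split; intros t; [apply is_derive_kummer_pseries, Hcv|].
  evar_last.
  - apply (is_derive_mult (fun t => - (t^2 / 3)) (fun t => PSeries (PS_derive u) (- t^3 / 9))).
    + instantiate (1 := - (2 * t / 3)). auto_derive; [exact I|]. field.
    + apply is_derive_kummer_pseries, Hcv1.
    + intros; apply Rmult_comm.
  - change (- (2 * t / 3) * PSeries (PS_derive u) (- t^3 / 9)
      + - (t^2 / 3) * (- (t^2 / 3) * PSeries (PS_derive (PS_derive u)) (- t^3 / 9))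
      = - (t^2 / 3) * (- (t^2 / 3) * PSeries (PS_derive u) (- t^3 / 9))
        - a * t * PSeries u (- t^3 / 9)).
    pose proof (kummer_equation a (2/3) (- t^3 / 9) Ha two_thirds_neq0) as E.
    fold u in E.
    set (k0 := PSeries u (- t^3 / 9)) in *.
    set (k1 := PSeries (PS_derive u) (- t^3 / 9)) in *.
    set (k2 := PSeries (PS_derive (PS_derive u)) (- t^3 / 9)) in *.
    replace (a * t * k0) with (t * (- t^3 / 9 * k2 + 2/3 * k1 - (- t^3 / 9 * k1)))
      by (rewrite E; ring).
    field.
Qed.

(** Kummer's equation with [b = 2/3] has the second solution [z^(1-b) M(a - b + 1, 2 - b, z)]. For
    [z = - t^3 / 9], [t] is proportional to the cube root of [z], which gives [t M(a + 1/3, 4/3, z)]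
    up to a constant. *)
Lemma second_kummer_solution : exists S1 : R -> R,
  (forall t, is_derive (fun t => t * PSeries v (- t^3 / 9)) t (S1 t)) /\
  (forall t, is_derive S1 t
     (- (t^2 / 3) * S1 t - a * t * (t * PSeries v (- t^3 / 9)))).
Proof.
  pose proof (CV_radius_kummer (a + 1/3) (4/3) Ha3 four_thirds_neq0) as Hcv. fold v in Hcv.
  assert (Hcv1 : CV_radius (PS_derive v) = p_infty) by (rewrite CV_radius_derive; exact Hcv).
  exists (fun t => PSeries v (- t^3 / 9) + - (t^3 / 3) * PSeries (PS_derive v) (- t^3 / 9)).
  split; intros t.
  - evar_last.
    + apply (is_derive_mult (fun t => t) (fun t => PSeries v (- t^3 / 9))).
      * apply (@is_derive_id R_AbsRing).
      * apply is_derive_kummer_pseries, Hcv.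
      * intros; apply Rmult_comm.
    + change (1 * PSeries v (- t^3 / 9) + t * (- (t^2 / 3) * PSeries (PS_derive v) (- t^3 / 9))
        = PSeries v (- t^3 / 9) + - (t^3 / 3) * PSeries (PS_derive v) (- t^3 / 9)). field.
  - evar_last.
    + apply (is_derive_plus (V := R_NormedModule) (fun t => PSeries v (- t^3 / 9))
        (fun t => - (t^3 / 3) * PSeries (PS_derive v) (- t^3 / 9))).
      * apply is_derive_kummer_pseries, Hcv.
      * apply (is_derive_mult (fun t => - (t^3 / 3))
          (fun t => PSeries (PS_derive v) (- t^3 / 9))).
        -- instantiate (1 := - t^2). auto_derive; [exact I|]. field.
        -- apply is_derive_kummer_pseries, Hcv1.
        -- intros; apply Rmult_comm.
    + change (- (t^2 / 3) * PSeries (PS_derive v) (- t^3 / 9)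
        + (- t^2 * PSeries (PS_derive v) (- t^3 / 9)
        + - (t^3 / 3) * (- (t^2 / 3) * PSeries (PS_derive (PS_derive v)) (- t^3 / 9)))
        = - (t^2 / 3) * (PSeries v (- t^3 / 9)
          + - (t^3 / 3) * PSeries (PS_derive v) (- t^3 / 9))
          - a * t * (t * PSeries v (- t^3 / 9))).
      pose proof (kummer_equation (a + 1/3) (4/3) (- t^3 / 9) Ha3 four_thirds_neq0) as E.
      fold v in E.
        set (k0 := PSeries v (- t^3 / 9)) in *.
      set (k1 := PSeries (PS_derive v) (- t^3 / 9)) in *.
      set (k2 := PSeries (PS_derive (PS_derive v)) (- t^3 / 9)) in *.
      replace (a * t * (t * k0))
        with (t^2 * (- t^3 / 9 * k2 + 4/3 * k1 - (- t^3 / 9 * k1) - 1/3 * k0))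
        by (rewrite E; ring).
      field.
Qed.

(** Since [poch x (S n) = n! n^x / gauss x n], the quotient of the coefficients of [u] and [v] is a
    quotient of [gauss] values times a power of [n] with exponent
    [(a + 4/3) - (2/3 + a + 1/3) = 1/3]. The two shift ratios in [k] trade [poch x (S n)] for
    [poch x n]. *)
Lemma kummer_cbrt_ratio (eps : R) : 0 < eps -> exists X, 1 <= X /\ forall x, X <= x ->
  Rabs (PSeries u x - Gamma (2/3) * Gamma (a + 1/3) / (Gamma a * Gamma (4/3))
          * (Rpower x (1/3) * PSeries v x))
    <= eps * (Rpower x (1/3) * Rabs (PSeries v x)).
Proof.
  intros Heps.
  set (k := fun n => gauss (2/3) n * gauss (a + 1/3) n / (gauss a n * gauss (4/3) n)
    * ((2/3 + INR n) / (a + INR n)) * ((a + 1/3 + INR n) / (4/3 + INR n))).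
  apply (pseries_cbrt_ratio u v k); [| | | | |exact Heps].
  - intros n. apply kummer_coef_neq0; [exact Ha3|apply four_thirds_neq0].
  - apply kummer_coef_ratio; [exact Ha3|apply four_thirds_neq0].
  - apply CV_radius_kummer; [exact Ha|apply two_thirds_neq0].
  - destruct (gauss_converges (2/3) two_thirds_neq0) as [L1 _].
    destruct (gauss_converges (4/3) four_thirds_neq0) as [L2 N2].
    destruct (gauss_converges a Ha) as [L3 N3].
    destruct (gauss_converges (a + 1/3) Ha3) as [L4 _].
    set (kappa := Gamma (2/3) * Gamma (a + 1/3) / (Gamma a * Gamma (4/3))).
    replace (Finite kappa) with (Finite (kappa * 1 * 1)) by (f_equal; ring).
    unfold k. apply is_lim_seq_mult'; [|apply is_lim_seq_shift_ratio].
    apply is_lim_seq_mult'; [|apply is_lim_seq_shift_ratio].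
    unfold kappa. apply is_lim_seq_div'.
    + apply is_lim_seq_mult'; assumption.
    + apply is_lim_seq_mult'; assumption.
    + apply Rmult_integral_contrapositive_currified; assumption.
  - intros n Hn. destruct n as [|m]; [lia|]. set (n := S m) in *.
    assert (Hn0 : 0 < INR n) by (apply lt_0_INR; lia).
    unfold k, gauss, u, v, kummer_coef.
    change (poch (2/3) (S n)) with (poch (2/3) n * (2/3 + INR n)).
    change (poch (4/3) (S n)) with (poch (4/3) n * (4/3 + INR n)).
    change (poch a (S n)) with (poch a n * (a + INR n)).
    change (poch (a + 1/3) (S n)) with (poch (a + 1/3) n * (a + 1/3 + INR n)).
    change (cbrt_seq n) with (Rpower (INR n) (1/3)).
    replace (Rpower (INR n) (4/3))
      with (Rpower (INR n) (2/3) * Rpower (INR n) (1/3) * Rpower (INR n) (1/3))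
      by (rewrite <- !Rpower_plus; f_equal; field).
    rewrite (Rpower_plus a).
    assert (Hpos : forall y, Rpower (INR n) y <> 0)
      by (intros y; apply Rgt_not_eq, exp_pos).
    pose proof (Hpos a). pose proof (Hpos (1/3)). pose proof (Hpos (2/3)).
    pose proof (INR_fact_neq_0 n). pose proof (Ha n). pose proof (Ha3 n).
    pose proof (two_thirds_neq0 n). pose proof (four_thirds_neq0 n).
    pose proof (poch_neq0 a n Ha). pose proof (poch_neq0 (a + 1/3) n Ha3).
    pose proof (poch_neq0 (2/3) n two_thirds_neq0).
    pose proof (poch_neq0 (4/3) n four_thirds_neq0).
    set (p1 := poch a n) in *. set (p2 := poch (a + 1/3) n) in *.
    set (p3 := poch (2/3) n) in *. set (p4 := poch (4/3) n) in *.
    set (r1 := Rpower (INR n) a) in *. set (r2 := Rpower (INR n) (1/3)) in *.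
    set (r3 := Rpower (INR n) (2/3)) in *. set (f := INR (Factorial.fact n)) in *.
    set (nn := INR n) in *.
    field. repeat split; lra.
Qed.

(** One term of the series beats the power weight: in degree [N >= |mu|] it supplies [(s^3/9)^N],
    while the weight costs at most [(2 s^2)^N]. This leaves [s * (s/18)^N] up to a constant, whence
    the [18] in [cN]; its factor [1/2] comes from [abs_series_le_twice]. *)
Lemma second_kummer_large (mu M : R) : exists S, forall s, S <= s ->
  M <= Rabs (Rpower (1 + (- s)^2) mu * (- s * PSeries v (- (- s)^3 / 9))).
Proof.
  assert (Hv : forall n, v n <> 0)
    by (intros n; apply kummer_coef_neq0; [exact Ha3|apply four_thirds_neq0]).
  assert (Hr : is_lim_seq (fun n => INR (S n) * v (S n) / v n) 1)
    by (apply kummer_coef_ratio; [exact Ha3|apply four_thirds_neq0]).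
  destruct (abs_series_le_twice v Hv Hr) as [X [HX HS]].
  set (N := Z.to_nat (up (Rabs mu))).
  assert (HN : Rabs mu <= INR N).
  { unfold N. destruct (archimed (Rabs mu)). pose proof (Rabs_pos mu).
    rewrite INR_IZR_INZ, Z2Nat.id; [lra|]. apply le_IZR. lra. }
  set (eN := Rabs (v N)).
  assert (HeN : 0 < eN) by apply Rabs_pos_lt, Hv.
  set (cN := eN / 2 * / 18^N).
  assert (HcN : 0 < cN).
  { unfold cN. apply Rmult_lt_0_compat; [lra|]. apply Rinv_0_lt_compat, pow_lt. lra. }
  exists (9 * X + Rabs M / cN). intros s Hs.
  assert (0 <= Rabs M / cN) by (apply Rdiv_le_0_compat; [apply Rabs_pos|exact HcN]).
  assert (Hs9 : 9 * X <= s) by lra.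
  assert (Hs1 : 1 <= s) by lra.
  replace ((- s)^2) with (s^2) by ring.
  replace (- (- s)^3 / 9) with (s^3 / 9) by field.
  set (x := s^3 / 9).
  assert (Hx : X <= x).
  { unfold x. assert (s <= s^3) by (assert (1 <= s^2) by nra; nra). lra. }
  specialize (HS x Hx).
  assert (HE : eN * x^N <= Series (fun n => Rabs (v n) * x^n)).
  { apply (Series_ge_term (fun n => Rabs (v n) * x^n) N).
    - intros n. apply Rmult_le_pos; [apply Rabs_pos|apply pow_le; lra].
    - apply (ex_series_infinite (fun n => Rabs (v n)) x).
      apply CV_radius_infinite_ratio with 1.
      + intros n. apply Rabs_no_R0, Hv.
      + apply is_lim_seq_ratio_abs, Hr. }
  rewrite !Rabs_mult, Rabs_Ropp, (Rabs_right s) by lra.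
  rewrite (Rabs_right (Rpower (1 + s^2) mu)) by (apply Rle_ge; left; apply exp_pos).
  apply Rle_trans with (/ (2 * s^2)^N * (s * (eN * x^N / 2))).
  - replace (/ (2 * s^2)^N * (s * (eN * x^N / 2))) with (s * cN * s^N).
    + apply Rle_trans with (Rabs M); [apply Rle_abs|].
      assert (Rabs M <= s * cN).
      { replace (Rabs M) with (Rabs M / cN * cN) by (field; lra).
        apply Rmult_le_compat_r; lra. }
      assert (1 <= s^N) by (apply pow_R1_Rle; exact Hs1).
      assert (0 <= s * cN) by (apply Rmult_le_pos; lra). nra.
    + unfold cN, x.
      assert (E : s^N * (2 * s^2)^N = 18^N * (s^3 / 9)^N).
      { rewrite <- !Rpow_mult_distr. f_equal. field. }
      assert (H18 : 18^N <> 0) by (apply pow_nonzero; lra).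
      assert (H2s : (2 * s^2)^N <> 0) by (apply pow_nonzero; nra).
      apply Rmult_eq_reg_r with ((2 * s^2)^N); [|exact H2s].
      transitivity (s * (eN / 2 * / 18^N) * (s^N * (2 * s^2)^N)); [ring|].
      rewrite E. field. split; assumption.
  - apply Rmult_le_compat.
    + left. apply Rinv_0_lt_compat, pow_lt. nra.
    + apply Rmult_le_pos; [lra|]. assert (0 <= x^N) by (apply pow_le; lra). nra.
    + apply Rpower_weight_lower; assumption.
    + apply Rmult_le_compat_l; lra.
Qed.

End KummerSolutions.

(** The parameters [a] and [a + 1/3] are sixths with numerators [-1 - 6k] and [1 - 6k]. Avoiding the
    nonpositive integers makes their Gamma values genuine and nonzero, and keeps every Kummer
    coefficient nonzero. *)
Lemma sixth_neq0 (p : Z) (m : nat) : (p mod 6 <> 0)%Z -> IZR p / 6 + INR m <> 0.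
Proof.
  intros Hp E. rewrite INR_IZR_INZ in E.
  assert (H : IZR (p + 6 * Z.of_nat m) = IZR 0).
  { rewrite plus_IZR, mult_IZR. lra. }
  apply eq_IZR in H. apply Hp.
  replace p with ((- Z.of_nat m) * 6)%Z by lia. apply Z_mod_mult.
Qed.

Lemma cube_inj_pos (y z : R) : 0 < y -> 0 < z -> y^3 = z^3 -> y = z.
Proof.
  intros Hy Hz E.
  assert (H : (y - z) * (y^2 + y * z + z^2) = 0) by (ring_simplify; lra).
  apply Rmult_integral in H. destruct H; nra.
Qed.

Theorem lemma2p15 : forall k : Z, exists C : R, 0 < C /\
  forall t : R,
    Rabs (Lambda k t) + Rabs (t ^ 3 * Derive_n (Lambda k) 1 t)
    + Rabs (t ^ 4 * Derive_n (Lambda k) 2 t)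
    + Rabs (t ^ 5 * Derive_n (Lambda k) 3 t) <= C.
Proof.
  intros k. set (a := -1/6 - IZR k).
  assert (Ha : forall m, a + INR m <> 0).
  { intros m. replace a with (IZR (-1 - 6 * k) / 6)
      by (unfold a; rewrite minus_IZR, mult_IZR; field).
    apply sixth_neq0. replace (-1 - 6 * k)%Z with (5 + (- k - 1) * 6)%Z by ring.
    rewrite Z_mod_plus_full. discriminate. }
  assert (Ha3 : forall m, a + 1/3 + INR m <> 0).
  { intros m. replace (a + 1/3) with (IZR (1 - 6 * k) / 6)
      by (unfold a; rewrite minus_IZR, mult_IZR; field).
    apply sixth_neq0. replace (1 - 6 * k)%Z with (1 + (- k) * 6)%Z by ring.
    rewrite Z_mod_plus_full. discriminate. }
  set (mu := -1/4 - 3 * IZR k / 2).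
  assert (Hmu : mu = 3 * a / 2) by (unfold mu, a; field).
  set (w := Rpower 9 (1/3)).
  assert (Hw : 0 < w) by apply exp_pos.
  assert (Hw3 : w^3 = 9) by (apply Rpower_third_cube; lra).
  set (A := Gamma (1/3) / Gamma (a + 1/3)).
  set (B := Gamma (-1/3) / Gamma a).
  set (kappa := Gamma (2/3) * Gamma (a + 1/3) / (Gamma a * Gamma (4/3))).
  assert (Hcancel : A * kappa + B = 0).
  { destruct (gauss_converges a Ha) as [_ N1].
    destruct (gauss_converges (a + 1/3) Ha3) as [_ N2].
    assert (H13 : forall m, 1/3 + INR m <> 0) by (intros m; pose proof (pos_INR m); lra).
    assert (Hm13 : forall m, -1/3 + INR m <> 0).
    { intros m. replace (-1/3) with (IZR (-2) / 6) by field.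
      apply sixth_neq0. discriminate. }
    destruct (gauss_converges (1/3) H13) as [_ N3].
    unfold A, B, kappa.
    replace (4/3) with (1/3 + 1) by field. rewrite (Gamma_succ (1/3) H13).
    replace (2/3) with (-1/3 + 1) by field. rewrite (Gamma_succ (-1/3) Hm13).
    field. repeat split; assumption. }
  set (u := kummer_coef a (2/3)). set (v := kummer_coef (a + 1/3) (4/3)).
  set (D := fun t => t * PSeries v (- t^3 / 9)).
  set (F := fun t => A * PSeries u (- t^3 / 9) + - (B / w) * D t).
  destruct (first_kummer_solution a Ha) as [U1 [HU HU1]]. fold u in HU, HU1.
  destruct (second_kummer_solution a Ha3) as [D1 [HD HD1]]. fold v in HD, HD1.
  destruct (weighted_solution_bounded a mu F (fun t => A * U1 t + - (B / w) * D1 t) D D1 Hmu)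
    as [G1 [G2 [G3 [HG [HG1 [HG2 [K HK]]]]]]].
  - intros t. unfold F.
    apply (is_derive_plus (V := R_NormedModule) (fun t => A * PSeries u (- t^3 / 9))
      (fun t => - (B / w) * D t)); apply is_derive_scal; [apply HU|apply HD].
  - intros t. evar_last.
    + apply (is_derive_plus (V := R_NormedModule) (fun t => A * U1 t)
        (fun t => - (B / w) * D1 t)); apply is_derive_scal; [apply HU1|apply HD1].
    + unfold F, D. cbv [plus]; simpl. ring.
  - exact HD.
  - exact HD1.
  - intros eps M Heps.
    destruct (second_kummer_large a Ha3 mu M) as [S HS].
    (* The [+ 1] keeps the denominator positive without any information on [A]; the [w] offsets the
       division in [x^(1/3) = s / w]. *)
    set (eps' := eps * w / (Rabs A + 1)).
    pose proof (Rabs_pos A) as HA0.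
    assert (Heps' : 0 < eps').
    { unfold eps'. apply Rdiv_lt_0_compat; [apply Rmult_lt_0_compat; lra|lra]. }
    destruct (kummer_cbrt_ratio a Ha Ha3 eps' Heps') as [X [HX Hratio]].
    fold u v kappa in Hratio. fold v in HS.
    exists (Rmax (Rmax M S) (9 * X)).
    set (s := Rmax (Rmax M S) (9 * X)).
    assert (HsM : M <= s) by (apply Rle_trans with (2 := Rmax_l _ _), Rmax_l).
    assert (HsS : S <= s) by (apply Rle_trans with (2 := Rmax_l _ _), Rmax_r).
    assert (HsX : 9 * X <= s) by apply Rmax_r.
    clearbody s.
    split; [exact HsM|split; [apply HS, HsS|]].
    unfold F, D. replace (- (- s)^3 / 9) with (s^3 / 9) by field.
    set (x := s^3 / 9).
    assert (Hx : X <= x).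
    { unfold x. assert (s <= s^3) by (assert (1 <= s^2) by nra; nra). lra. }
    specialize (Hratio x Hx).
    assert (HY : Rpower x (1/3) = s / w).
    { apply cube_inj_pos.
      - apply exp_pos.
      - apply Rdiv_lt_0_compat; lra.
      - rewrite Rpower_third_cube by lra. unfold x.
        rewrite <- Hw3. field. lra. }
    rewrite HY in Hratio.
    set (p := PSeries u x) in *. set (q := PSeries v x) in *.
    (* As [B = - A * kappa], the bracket at [-s] is exactly [A] times the difference estimated in
       [Hratio]. *)
    replace (A * p + - (B / w) * (- s * q)) with (A * (p - kappa * (s / w * q))).
    2:{ replace B with (- (A * kappa)) by lra. field. lra. }
    rewrite !Rabs_mult, Rabs_Ropp, (Rabs_right s) by lra.
    apply Rle_trans with (Rabs A * (eps' * (s / w * Rabs q))).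
    + apply Rmult_le_compat_l; assumption.
    + replace (Rabs A * (eps' * (s / w * Rabs q)))
        with (Rabs A / (Rabs A + 1) * (eps * (s * Rabs q))) by (unfold eps'; field; lra).
      rewrite <- (Rmult_1_l (eps * (s * Rabs q))) at 2.
      apply Rmult_le_compat_r.
      * apply Rmult_le_pos; [lra|]. apply Rmult_le_pos; [lra|apply Rabs_pos].
      * apply Rmult_le_reg_r with (Rabs A + 1); [lra|].
        unfold Rdiv. rewrite Rmult_assoc, Rinv_l by lra. lra.
  - set (c := Rpower 9 (1/6 + IZR k)).
    assert (HL : forall t, Lambda k t = c * (Rpower (1 + t^2) mu * F t)).
    { intros t. unfold Lambda, F, D. rewrite !KummerM_PSeries.
      replace (1/6 - IZR k) with (a + 1/3) by (unfold a; field).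
      fold a mu c w u v A B. unfold Rdiv. ring. }
    (* [Derive_n] iterates the total function [Derive]; its values are identified one order at a
       time, each from a genuine derivative of the preceding one. *)
    assert (L1 : forall t, Derive_n (Lambda k) 1 t = c * G1 t).
    { intros t. apply is_derive_unique.
      apply is_derive_ext with (fun t => c * (Rpower (1 + t^2) mu * F t)).
      - intros y. symmetry. apply HL.
      - apply is_derive_scal, HG. }
    assert (L2 : forall t, Derive_n (Lambda k) 2 t = c * G2 t).
    { intros t. apply is_derive_unique.
      apply is_derive_ext with (fun t => c * G1 t).
      - intros y. symmetry. apply L1.
      - apply is_derive_scal, HG1. }
    assert (L3 : forall t, Derive_n (Lambda k) 3 t = c * G3 t).
    { intros t. apply is_derive_unique.
      apply is_derive_ext with (fun t => c * G2 t).
      - intros y. symmetry. apply L2.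
      - apply is_derive_scal, HG2. }
    assert (Hc : 0 < c) by apply exp_pos.
    exists (c * Rabs K + 1). split.
    { pose proof (Rabs_pos K). nra. }
    intros t. rewrite HL, L1, L2, L3.
    replace (t^3 * (c * G1 t)) with (c * (t^3 * G1 t)) by ring.
    replace (t^4 * (c * G2 t)) with (c * (t^4 * G2 t)) by ring.
    replace (t^5 * (c * G3 t)) with (c * (t^5 * G3 t)) by ring.
    rewrite 4!(Rabs_mult c), (Rabs_right c) by lra.
    specialize (HK t). pose proof (Rle_abs K).
    rewrite <- !Rmult_plus_distr_l.
    apply Rle_trans with (c * K); [apply Rmult_le_compat_l; lra|].
    assert (c * K <= c * Rabs K) by (apply Rmult_le_compat_l; lra). lra.
Qed.
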